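(* Let $H$ be a Hopf algebra with bijective antipode over a field $k$, let $(H,B)$ be a Hopf admissible pair (i.e. $B$ is a Hopf algebra in ${}_H^H\mathcal{YD}$), and let $\sigma:B\otimes B\to k$ be pure (respectively neat) in ${}_H^H\mathcal{YD}$. Define $\overline{\sigma}:(B\times H)\otimes(B\times H)\to k$ by $$\overline{\sigma}(b\times h,b'\times h')=\sigma(b\otimes h\cdot b')\,\varepsilon(h'),\qquad b,b'\in B,\ h,h'\in H.$$ Then $\overline{\sigma}$ is pure (respectively neat) on the Radford biproduct $B\times H$. In particular, if $\sigma$ is a pure (respectively neat) lazy 2-cocycle in ${}_H^H\mathcal{YD}$, then $\overline{\sigma}$ is a pure (respectively neat) lazy 2-cocycle for $B\times H$.
   Context: Sweedler notation $\Delta(x)=x_1\otimes x_2$ (iterated: $x_1\otimes x_2\otimes x_3$) is used for all coalgebras. **Hopf admissible pairs.** $(H,B)$ is an admissible pair if $B$ is an algebra and a coalgebra with a left $H$-action $h\otimes b\mapsto h\cdot b$ and a left $H$-coaction $b\mapsto b^{(-1)}\otimes b^{(0)}\in H\otimes B$ such that: $B$ is a left $H$-module algebra, left $H$-comodule algebra, left $H$-module coalgebra and left $H$-comodule coalgebra; $\varepsilon_B$ is an algebra map and $\Delta_B(1)=1\otimes1$; $\Delta_B(bc)=b_1(b_2^{(-1)}\cdot c_1)\otimes b_2^{(0)}c_2$; and $(h_1\cdot b)^{(-1)}h_2\otimes(h_1\cdot b)^{(0)}=h_1b^{(-1)}\otimes h_2\cdot b^{(0)}$. It is a Hopf admissible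 pair if moreover $\mathrm{id}_B$ has a convolution inverse $S_B$ in $\mathrm{Hom}(B,B)$. Equivalently, $B$ is a Hopf algebra in the category ${}_H^H\mathcal{YD}$ of left Yetter–Drinfeld modules. **Radford biproduct.** $B\times H$ is $B\otimes H$ with multiplication $(b\times h)(b'\times h')=b(h_1\cdot b')\times h_2h'$, unit $1\times1$, comultiplication $\Delta(b\times h)=(b_1\times b_2^{(-1)}h_1)\otimes(b_2^{(0)}\times h_2)$ and counit $\varepsilon_B\otimes\varepsilon_H$; it is a Hopf algebra when $(H,B)$ is a Hopf admissible pair. **Notions in ${}_H^H\mathcal{YD}$.** A morphism $\sigma:B\otimes B\to k$ in ${}_H^H\mathcal{YD}$ is a linear map with $\sigma(h_1\cdot b\otimes h_2\cdot b')=\varepsilon(h)\sigma(b\otimes b')$ and $\sigma(b^{(0)}\otimes b'^{(0)})b^{(-1)}b'^{(-1)}=\sigma(b\otimes b')1_H$. Convolution of such morphisms in ${}_H^H\mathcal{YD}$ is $(\sigma*\tau)(b\otimes b')=\sigma(b_1\otimes b_2^{(-1)}\cdot b'_1)\tau(b_2^{(0)}\otimes b'_2)$; convolution invertibility in ${}_H^H\mathcal{YD}$ and $\sigma^{-1}$ refer to this product, with $\sigma^{-1}$ a morphism in ${}_H^H\mathcal{YD}$. Normalized means $\sigma(1\otimes b)=\sigma(b\otimes1)=\varepsilon(b)$. A normalized, convolution invertible morphism $\sigma:B\otimes B\to k$ in ${}_H^H\mathcal{YD}$ is: - pure in ${}_H^H\mathcal{YD}$ if for all $a,b,c,d\in B$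 $$\sigma(ab_1\otimes b_2^{(-1)}\cdot c_1)\,\sigma^{-1}((b_2^{(0)})_1\otimes(b_2^{(0)})_2^{(-1)}\cdot c_2)\,\sigma((b_2^{(0)})_2^{(0)}\otimes c_3d)$$ $$=\sigma\bigl(b_1\otimes[b_2^{(-1)}\cdot c_1][(b_2^{(0)})_2^{(0)(-1)}c_3^{(-1)}\cdot d]\bigr)\,\sigma^{-1}((b_2^{(0)})_1\otimes(b_2^{(0)})_2^{(-1)}\cdot c_2)\,\sigma(a(b_2^{(0)})_2^{(0)(0)}\otimes c_3^{(0)})$$ (here one first comultiplies $b$, coacts on $b_2$, comultiplies $b_2^{(0)}$, then coacts on $(b_2^{(0)})_2$, once on the left-hand side and twice on the right-hand side, where $x^{(0)(-1)}\otimes x^{(0)(0)}$ denotes the coaction applied to $x^{(0)}$); - neat in ${}_H^H\mathcal{YD}$ if $\sigma(a\otimes b_1)\sigma(b_2\otimes c)=\sigma(a^{(-1)}\cdot b_1\otimes c)\sigma(a^{(0)}\otimes b_2)$ for all $a,b,c\in B$; - lazy in ${}_H^H\mathcal{YD}$ if $\sigma(b_1\otimes b_2^{(-1)}\cdot b'_1)b_2^{(0)}b'_2=\sigma(b_2^{(0)}\otimes b'_2)b_1(b_2^{(-1)}\cdot b'_1)$ for all $b,b'\in B$; - a (left) 2-cocycle in ${}_H^H\mathcal{YD}$ if $\sigma(a_1\otimes a_2^{(-1)}\cdot b_1)\sigma(a_2^{(0)}b_2\otimes c)=\sigma(b_1\otimes b_2^{(-1)}\cdot c_1)\sigma(a\otimes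 b_2^{(0)}c_2)$ for all $a,b,c\in B$. **Notions on an ordinary Hopf algebra $K$ (here $K=B\times H$).** A normalized, (ordinary) convolution invertible linear map $\tau:K\otimes K\to k$ is: - pure if $\tau(ab_1,c_1)\tau^{-1}(b_2,c_2)\tau(b_3,c_3d)=\tau(b_1,c_1d)\tau^{-1}(b_2,c_2)\tau(ab_3,c_3)$ for all $a,b,c,d\in K$; - neat if $\tau(a,b_1)\tau(b_2,c)=\tau(b_1,c)\tau(a,b_2)$ for all $a,b,c\in K$; - lazy if $\tau(x_1,y_1)x_2y_2=x_1y_1\tau(x_2,y_2)$ for all $x,y\in K$; - a (left) 2-cocycle if $\tau(a_1,b_1)\tau(a_2b_2,c)=\tau(b_1,c_1)\tau(a,b_2c_2)$ for all $a,b,c\in K$. Known fact (cited by the paper): if $\sigma$ is a convolution invertible normalized lazy left 2-cocycle in ${}_H^H\mathcal{YD}$, then $\overline{\sigma}$ is a normalized convolution invertible lazy left 2-cocycle on $B\times H$, with inverse $\overline{\sigma}^{-1}(b\times h,b'\times h')=\sigma^{-1}(b\otimes h\cdot b')\varepsilon(h')$. *)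

(* Defs.v *)
From HB Require Import structures.
From mathcomp Require Import all_boot all_algebra generic_quotient.
From mathcomp Require Import boolp.

Set Implicit Arguments.
Unset Strict Implicit.
Unset Printing Implicit Defensive.

Import GRing.Theory.
Local Open Scope ring_scope.
Local Open Scope quotient_scope.

Reserved Notation "u \ot v" (at level 45, right associativity).
Reserved Notation "'\sw_' ( x , y <- t ) E"
  (at level 46, x name, y name, t at level 100, E at level 46,
   format "'[' '\sw_' ( x ,  y  <-  t ) '/  '  E ']'").

Definition bilin (k : fieldType) (U V W : lmodType k) (f : U -> V -> W) : Prop :=
  (forall v, linear (f^~ v)) /\ (forall u, linear (f u)).

(* The tensor product over k: finite formal sums of pairs (u, v), two of them
   being identified when every bilinear map takes the same value on both. *)
Section TensorDef.
Variables (k : fieldType) (U V : lmodType k).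

Definition feval (W : nmodType) (f : U -> V -> W) (s : seq (U * V)) : W :=
  \sum_(p <- s) f p.1 p.2.

Definition fequiv (s t : seq (U * V)) : bool :=
  `[< forall (W : lmodType k) (f : U -> V -> W), bilin f -> feval f s = feval f t >].

Lemma fequivP s t : reflect
  (forall (W : lmodType k) (f : U -> V -> W), bilin f -> feval f s = feval f t)
  (fequiv s t).
Proof. exact: asboolP. Qed.

Lemma fequiv_is_equiv : equiv_class_of fequiv.
Proof.
split=> [s|s t|t s u]; first exact/fequivP.
  by apply/fequivP/fequivP => h W f hf; rewrite h.
move=> /fequivP h1 /fequivP h2; apply/fequivP => W f hf.
by rewrite h1 // h2.
Qed.

Canonical fequiv_equiv := EquivRelPack fequiv_is_equiv.
Canonical fequiv_encModRel := defaultEncModRel fequiv.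

Definition tensor := {eq_quot fequiv}.
HB.instance Definition _ : EqQuotient _ fequiv tensor := EqQuotient.on tensor.
HB.instance Definition _ := Choice.on tensor.

(* Sweedler sums: t is a sum of some u_i (x) v_i, and tsum f t is the sum of the
   f u_i v_i. For f bilinear it does not depend on the representation of t
   (tsum_ot, tsum_linear). *)
Definition tsum (W : nmodType) (f : U -> V -> W) (t : tensor) : W := feval f (repr t).

Definition tens_class (s : seq (U * V)) : tensor := \pi s.
Definition ot (u : U) (v : V) : tensor := tens_class [:: (u, v)].

Lemma tsum_pi (W : lmodType k) (f : U -> V -> W) s :
  bilin f -> tsum f (tens_class s) = feval f s.
Proof.
move=> hf; rewrite /tsum.
have /fequivP -> // : fequiv (repr (tens_class s)) s.
by apply/eqmodP; rewrite reprK.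
Qed.

Lemma tensor_eqP (s t : tensor) :
  (forall (W : lmodType k) (f : U -> V -> W), bilin f -> tsum f s = tsum f t) -> s = t.
Proof.
move=> h; rewrite -[s]reprK -[t]reprK; apply/eqmodP/fequivP => W f hf; exact: h.
Qed.

Definition tens0 : tensor := tens_class [::].
Definition tens_add (s t : tensor) : tensor := tens_class (repr s ++ repr t).
Definition tens_scale (a : k) (t : tensor) : tensor :=
  tens_class [seq (a *: p.1, p.2) | p <- repr t].
Definition tens_opp := tens_scale (-1).

Section Eval.
Variables (W : lmodType k) (f : U -> V -> W).
Hypothesis hf : bilin f.

Lemma tsum_add s t : tsum f (tens_add s t) = tsum f s + tsum f t.
Proof. by rewrite tsum_pi // /feval big_cat. Qed.
Lemma tsum_0 : tsum f tens0 = 0.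
Proof. by rewrite tsum_pi // /feval big_nil. Qed.
Lemma tsum_scale a t : tsum f (tens_scale a t) = a *: tsum f t.
Proof.
rewrite tsum_pi // /feval big_map scaler_sumr; apply: eq_bigr => p _ /=.
exact: (scalable_linear (hf.1 p.2)).
Qed.
End Eval.

Let evE := (tsum_add, tsum_0, tsum_scale).

Fact tens_addA : associative tens_add.
Proof. by move=> x y z; apply: tensor_eqP => W f hf; rewrite !evE // addrA. Qed.
Fact tens_addC : commutative tens_add.
Proof. by move=> x y; apply: tensor_eqP => W f hf; rewrite !evE // addrC. Qed.
Fact tens_add0 : left_id tens0 tens_add.
Proof. by move=> x; apply: tensor_eqP => W f hf; rewrite !evE // add0r. Qed.
Fact tens_addN : left_inverse tens0 tens_opp tens_add.
Proof.
by move=> x; apply: tensor_eqP => W f hf; rewrite !evE // scaleN1r addNr.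
Qed.
HB.instance Definition _ :=
  GRing.isZmodule.Build tensor tens_addA tens_addC tens_add0 tens_addN.

Fact tens_scaleA a b v : tens_scale a (tens_scale b v) = tens_scale (a * b) v.
Proof. by apply: tensor_eqP => W f hf; rewrite !evE // scalerA. Qed.
Fact tens_scale1 : left_id 1 tens_scale.
Proof. by move=> v; apply: tensor_eqP => W f hf; rewrite !evE // scale1r. Qed.
Fact tens_scaleDr : right_distributive tens_scale +%R.
Proof. by move=> a u v; apply: tensor_eqP => W f hf; rewrite !evE // scalerDr. Qed.
Fact tens_scaleDl v : {morph tens_scale^~ v : a b / a + b >-> a + b}.
Proof. by move=> a b; apply: tensor_eqP => W f hf; rewrite !evE // scalerDl. Qed.
HB.instance Definition _ := GRing.Zmodule_isLmodule.Build k tensor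
  tens_scaleA tens_scale1 tens_scaleDr tens_scaleDl.

End TensorDef.

Notation "u \ot v" := (ot u v) : ring_scope.
Notation "\sw_ ( x , y <- t ) E" := (tsum (fun x y => E) t) : ring_scope.

Section TensorTheory.
Variable k : fieldType.
Implicit Types U V W : lmodType k.

Lemma tsum_ot U V W (f : U -> V -> W) u v : bilin f -> tsum f (u \ot v) = f u v.
Proof. by move=> hf; rewrite tsum_pi // /feval big_seq1. Qed.

Lemma tsum_linear U V W (f : U -> V -> W) : bilin f -> linear (tsum f).
Proof. by move=> hf a x y; rewrite tsum_add // tsum_scale. Qed.

Lemma ot_bilin U V : bilin (@ot k U V).
Proof.
by split=> [v a x y|u a x y]; apply: tensor_eqP => W f hf;
   rewrite tsum_linear // !tsum_ot // ?(hf.1 _ _ _ _) ?(hf.2 _ _ _ _).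
Qed.

Lemma tsum_id U V (t : tensor U V) : \sw_(u, v <- t) (u \ot v) = t.
Proof.
apply: tensor_eqP => W f hf; rewrite [RHS]/tsum [X in tsum f X]/tsum.
elim: (repr t) => [|p s IHs]; first by rewrite /feval !big_nil [LHS]tsum_0.
rewrite /feval !big_cons [LHS]tsum_add // [LHS]/= tsum_ot //; congr (_ + _).
exact: IHs.
Qed.

Lemma eq_tsum U V (W : nmodType) (f g : U -> V -> W) t :
  (forall u v, f u v = g u v) -> tsum f t = tsum g t.
Proof. by move=> fg; rewrite /tsum /feval; apply: eq_bigr => p _; exact: fg. Qed.

Lemma app_tsum U V W W' (g : W -> W') (f : U -> V -> W) t :
  linear g -> g (\sw_(u, v <- t) f u v) = \sw_(u, v <- t) g (f u v).
Proof.
move=> hg; pose G := GRing.isLinear.Build _ _ _ _ g hg.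
pose L : {linear W -> W'} := HB.pack g G.
by rewrite /tsum /feval -[g _]/(L _) raddf_sum.
Qed.

Lemma exchange_tsum U V U' V' (W : nmodType) (f : U -> V -> U' -> V' -> W) s t :
  \sw_(u, v <- s) \sw_(x, y <- t) f u v x y =
  \sw_(x, y <- t) \sw_(u, v <- s) f u v x y.
Proof. exact: exchange_big. Qed.

Lemma tensor_ext U V W (f g : tensor U V -> W) :
  linear f -> linear g -> (forall u v, f (u \ot v) = g (u \ot v)) -> f =1 g.
Proof.
move=> hf hg fg t; rewrite -[t]tsum_id !app_tsum //.
by apply: eq_tsum => u v; exact: fg.
Qed.

Lemma lin_id U : linear (fun x : U => x). Proof. by []. Qed.
Lemma lin_scale U W (f : U -> W) a : linear f -> linear (fun x : U => a *: f x).
Proof. by move=> hf b x y; rewrite hf scalerDr !scalerA mulrC. Qed.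
Lemma lin_scalel U W (f : U -> k) w : linear (f : U -> k^o) -> linear ((fun x => f x *: w) : U -> W).
Proof. by move=> hf b x y; rewrite [f _]hf scalerDl scalerA. Qed.
Lemma lin_mull U (A : algType k) (f : U -> A) a :
  linear f -> linear (fun x : U => f x * a).
Proof. by move=> hf b x y; rewrite hf mulrDl scalerAl. Qed.
Lemma lin_mulr U (A : algType k) (f : U -> A) a :
  linear f -> linear (fun x : U => a * f x).
Proof. by move=> hf b x y; rewrite hf mulrDr scalerAr. Qed.
Lemma lin_otl U V W (f : U -> V) (w : W) : linear f -> linear (fun x : U => f x \ot w).
Proof. by move=> hf b x y; rewrite hf (ot_bilin _ _).1. Qed.
Lemma lin_otr U V W (f : U -> V) (w : W) : linear f -> linear (fun x : U => w \ot f x).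
Proof. by move=> hf b x y; rewrite hf (ot_bilin _ _).2. Qed.
Lemma lin_tsum U U1 U2 W (F : U -> U1 -> U2 -> W) t :
  (forall u v, linear (fun x : U => F x u v)) -> linear (fun x => \sw_(u, v <- t) F x u v).
Proof.
move=> hF a x y; rewrite /tsum /feval scaler_sumr -big_split.
by apply: eq_bigr => p _; rewrite /= hF.
Qed.
Lemma lin_tsum_arg U U1 U2 W (F : U1 -> U2 -> W) (f : U -> tensor U1 U2) :
  bilin F -> linear f -> linear (fun x : U => tsum F (f x)).
Proof. by move=> hF hf a x y; rewrite hf tsum_linear. Qed.
Lemma lin_bilinl U U1 U2 W (F : U1 -> U2 -> W) (f : U -> U1) v :
  bilin F -> linear f -> linear (fun x : U => F (f x) v).
Proof. by move=> hF hf a x y; rewrite hf hF.1. Qed.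
Lemma lin_bilinr U U1 U2 W (F : U1 -> U2 -> W) (f : U -> U2) v :
  bilin F -> linear f -> linear (fun x : U => F v (f x)).
Proof. by move=> hF hf a x y; rewrite hf hF.2. Qed.
Lemma lin_comp U V W (g : V -> W) (f : U -> V) :
  linear g -> linear f -> linear (fun x : U => g (f x)).
Proof. by move=> hg hf a x y; rewrite hf hg. Qed.
Lemma lin_kmull U (f : U -> k) a : linear (f : U -> k^o) -> linear (fun x : U => f x * a : k^o).
Proof. by move=> hf b x y; rewrite [f _]hf mulrDl scalerAl. Qed.
Lemma lin_kmulr U (f : U -> k) a : linear (f : U -> k^o) -> linear (fun x : U => a * f x : k^o).
Proof. by move=> hf b x y; rewrite [f _]hf mulrDr scalerAr. Qed.

End TensorTheory.

HB.mixin Record Lmodule_isCoalgebra (k : fieldType) C of GRing.Lmodule k C := {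
  comul : C -> tensor C C;
  counit : C -> k;
  comul_linear : linear comul;
  counit_linear : scalar counit;
  comulA : forall c,
    \sw_(x, y <- comul c) \sw_(x1, x2 <- comul x) (x1 \ot (x2 \ot y)) =
    \sw_(x, y <- comul c) (x \ot comul y);
  comul_counitl : forall c, \sw_(x, y <- comul c) (counit x *: y) = c;
  comul_counitr : forall c, \sw_(x, y <- comul c) (counit y *: x) = c
}.

#[short(type="coalgType")]
HB.structure Definition Coalgebra (k : fieldType) :=
  {C of Lmodule_isCoalgebra k C & GRing.Lmodule k C}.

(* No compatibility is required between product and coproduct: a Hopf algebra
   in the Yetter-Drinfeld category is not a bialgebra in the ordinary sense. *)
#[short(type="algCoalgType")]
HB.structure Definition AlgCoalg (k : fieldType) :=
  {A of GRing.Algebra k A & Lmodule_isCoalgebra k A}.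

HB.mixin Record AlgCoalg_isHopf (k : fieldType) A of AlgCoalg k A := {
  comulM : forall x y : A, comul (x * y) =
    \sw_(x1, x2 <- comul x) \sw_(y1, y2 <- comul y) ((x1 * y1) \ot (x2 * y2));
  comul1 : comul (1 : A) = 1 \ot 1;
  counitM : forall x y : A, counit (x * y) = counit x * counit y :> k;
  counit1 : counit (1 : A) = 1 :> k;
  antipode : A -> A;
  antipode_linear : linear antipode;
  antipodel : forall x, \sw_(x1, x2 <- comul x) (antipode x1 * x2) = (counit x : k) *: 1;
  antipoder : forall x, \sw_(x1, x2 <- comul x) (x1 * antipode x2) = (counit x : k) *: 1
}.

#[short(type="hopfAlgType")]
HB.structure Definition Hopf (k : fieldType) :=
  {A of AlgCoalg_isHopf k A & AlgCoalg k A}.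

Record admissible_pair (k : fieldType) (H : hopfAlgType k) (B : algCoalgType k) :=
  AdmissiblePair {
  yd_act : H -> B -> B;
  yd_coact : B -> tensor H B;
  yd_act_bilin : bilin yd_act;
  yd_coact_linear : linear yd_coact;
  yd_act1 : forall b, yd_act 1 b = b;
  yd_actM : forall h g b, yd_act (h * g) b = yd_act h (yd_act g b);
  yd_coactA : forall b,
    \sw_(h, c <- yd_coact b) \sw_(h1, h2 <- comul h) (h1 \ot (h2 \ot c)) =
    \sw_(h, c <- yd_coact b) (h \ot yd_coact c);
  yd_coact_counit : forall b, \sw_(h, c <- yd_coact b) (counit h *: c) = b;
  yd_act_mul : forall h b c, yd_act h (b * c) =
    \sw_(h1, h2 <- comul h) (yd_act h1 b * yd_act h2 c);
  yd_act_one : forall h, yd_act h 1 = (counit h : k) *: 1;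
  yd_coact_mul : forall b c, yd_coact (b * c) =
    \sw_(h, b0 <- yd_coact b) \sw_(g, c0 <- yd_coact c) ((h * g) \ot (b0 * c0));
  yd_coact_one : yd_coact 1 = 1 \ot 1;
  yd_act_comul : forall h b, comul (yd_act h b) =
    \sw_(h1, h2 <- comul h) \sw_(b1, b2 <- comul b) (yd_act h1 b1 \ot yd_act h2 b2);
  yd_act_counit : forall h b, counit (yd_act h b) = counit h * counit b :> k;
  yd_coact_comul : forall b,
    \sw_(h, c <- yd_coact b) (h \ot comul c) =
    \sw_(b1, b2 <- comul b) \sw_(h, c1 <- yd_coact b1) \sw_(g, c2 <- yd_coact b2)
      ((h * g) \ot (c1 \ot c2));
  yd_coact_counit_r : forall b,
    \sw_(h, c <- yd_coact b) (counit c *: h) = (counit b : k) *: 1;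
  yd_counit1 : counit (1 : B) = 1 :> k;
  yd_counitM : forall b c : B, counit (b * c) = counit b * counit c :> k;
  yd_comul1 : comul (1 : B) = 1 \ot 1;
  yd_comulM : forall b c : B, comul (b * c) =
    \sw_(b1, b2 <- comul b) \sw_(h, b20 <- yd_coact b2) \sw_(c1, c2 <- comul c)
      ((b1 * yd_act h c1) \ot (b20 * c2));
  yd_compat : forall h b,
    \sw_(h1, h2 <- comul h) \sw_(g, c <- yd_coact (yd_act h1 b)) ((g * h2) \ot c) =
    \sw_(h1, h2 <- comul h) \sw_(g, c <- yd_coact b) ((h1 * g) \ot yd_act h2 c)
}.

Definition hopf_admissible (k : fieldType) (H : hopfAlgType k) (B : algCoalgType k)
    (P : admissible_pair H B) : Prop :=
  exists S : B -> B, [/\ linear S,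
    forall b, \sw_(b1, b2 <- comul b) (S b1 * b2) = (counit b : k) *: 1 &
    forall b, \sw_(b1, b2 <- comul b) (b1 * S b2) = (counit b : k) *: 1].

Ltac mlin :=
  repeat (intros; cbn beta;
    first [ assumption | exact: comul_linear | exact: yd_coact_linear
          | exact: counit_linear | exact: ot_bilin | exact: yd_act_bilin
          | exact: (yd_act_bilin _).1 | exact: (yd_act_bilin _).2
          | exact: (ot_bilin _ _).1 | exact: (ot_bilin _ _).2
          | progress match goal with
    | |- bilin _ => split
    | |- GRing.linear_for _ (GRing.mul ?a) => apply: (lin_mulr a (@lin_id _ _))
    | |- GRing.linear_for _ (fun x => x) => exact: lin_id
    | |- GRing.linear_for _ (fun x => _ * _) =>
        first [apply: lin_mull | apply: lin_mulr | apply: lin_kmull | apply: lin_kmulr]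
    | |- GRing.linear_for _ (fun x => ot _ _) => first [apply: lin_otl | apply: lin_otr]
    | |- GRing.linear_for _ (fun x => tsum _ _) =>
       first [apply: lin_tsum_arg | apply: lin_tsum]
    | |- GRing.linear_for _ (fun x => yd_act _ _ _) =>
       first [apply: (lin_bilinl _ (yd_act_bilin _)) | apply: (lin_bilinr _ (yd_act_bilin _))]
    | |- GRing.linear_for _ (fun x => comul _) => apply: (lin_comp (@comul_linear _ _))
    | |- GRing.linear_for _ (fun x => counit _) => apply: (lin_comp (W := _^o) (@counit_linear _ _))
    | |- GRing.linear_for _ (fun x => yd_coact _ _) => apply: (lin_comp (yd_coact_linear _))
    | |- GRing.linear_for _ (fun x => _ *: _) => first [apply: lin_scalel | apply: lin_scale]
    end]).

Section Trilinear.
Variable k : fieldType.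

Definition trilin (U V X W : lmodType k) (F : U -> V -> X -> W) : Prop :=
  [/\ forall v x, linear (fun u : U => F u v x), forall u x, linear (fun v : V => F u v x)
   & forall u v, linear (F u v)].

Lemma trilin_bilin (U V X W : lmodType k) (F : U -> V -> X -> W) : trilin F ->
  bilin (fun u t => \sw_(v, x <- t) F u v x).
Proof. by case=> h1 h2 h3; mlin; [exact: h1|exact: h2|exact: h3]. Qed.

Lemma comulAE (C : coalgType k) (W : lmodType k) (F : C -> C -> C -> W) c :
  trilin F ->
  \sw_(x, y <- comul c) \sw_(x1, x2 <- comul x) F x1 x2 y =
  \sw_(x, y <- comul c) \sw_(y1, y2 <- comul y) F x y1 y2.
Proof.
move=> hF; have hb := trilin_bilin hF.
have := congr1 (fun t => \sw_(u, s <- t) \sw_(v, x <- s) F u v x) (comulA c).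
rewrite !(app_tsum _ _ (tsum_linear hb)).
under eq_tsum => x y.
  rewrite (app_tsum _ _ (tsum_linear hb)).
  under eq_tsum => x1 x2.
    rewrite tsum_ot // tsum_ot; last by case: hF => ? ? ?; split.
    over.
  over.
move=> ->; apply: eq_tsum => x y.
by rewrite tsum_ot.
Qed.

Lemma scale_ot (U V : lmodType k) (a : k) (u : U) (v : V) :
  a *: (u \ot v) = (a *: u) \ot v.
Proof. by rewrite (scalable_linear ((ot_bilin _ _).1 _)). Qed.
Lemma ot_scale (U V : lmodType k) (a : k) (u : U) (v : V) :
  u \ot (a *: v) = a *: (u \ot v).
Proof. by rewrite (scalable_linear ((ot_bilin _ _).2 _)). Qed.

Lemma tsum3 (U V X W : lmodType k) (F : U -> V -> X -> W) u v x : trilin F ->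
  \sw_(u, s <- u \ot (v \ot x)) \sw_(v, x <- s) F u v x = F u v x.
Proof.
move=> hF; rewrite tsum_ot; last exact: trilin_bilin.
by case: hF => ? ? ?; rewrite tsum_ot; last split.
Qed.

End Trilinear.

Section Biproduct.
Variables (k : fieldType) (H : hopfAlgType k) (B : algCoalgType k) (P : admissible_pair H B).
Local Notation "h \act b" := (yd_act P h b) (at level 38, right associativity).
Local Notation rho := (yd_coact P).

Definition bip_mul (x y : tensor B H) : tensor B H :=
  \sw_(b, h <- x) \sw_(c, g <- y) \sw_(h1, h2 <- comul h) ((b * h1 \act c) \ot (h2 * g)).
Definition bip_comul (x : tensor B H) : tensor (tensor B H) (tensor B H) :=
  \sw_(b, h <- x) \sw_(b1, b2 <- comul b) \sw_(g, c <- rho b2) \sw_(h1, h2 <- comul h)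
    ((b1 \ot g * h1) \ot (c \ot h2)).
Definition bip_counit (x : tensor B H) : k := \sw_(b, h <- x) (counit b * counit h).

Lemma bip_mul_bilin : bilin bip_mul.
Proof. by rewrite /bip_mul; mlin. Qed.
Lemma bip_comul_linear : linear bip_comul.
Proof. by rewrite /bip_comul; mlin. Qed.
Lemma bip_counit_linear : linear (bip_counit : _ -> k^o).
Proof. by rewrite /bip_counit; mlin. Qed.

Lemma bip_mulE b h c g : bip_mul (b \ot h) (c \ot g) =
  \sw_(h1, h2 <- comul h) (b * h1 \act c \ot h2 * g).
Proof.
rewrite /bip_mul tsum_ot; last by mlin.
by rewrite tsum_ot; last by mlin.
Qed.
Lemma bip_comulE b h : bip_comul (b \ot h) =
  \sw_(b1, b2 <- comul b) \sw_(g, c <- rho b2) \sw_(h1, h2 <- comul h)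
    ((b1 \ot g * h1) \ot (c \ot h2)).
Proof. by rewrite /bip_comul tsum_ot; last by mlin. Qed.
Lemma bip_counitE b h : bip_counit (b \ot h) = counit b * counit h.
Proof. by rewrite /bip_counit (tsum_ot (W := k^o)) //; mlin. Qed.

Lemma bip_mulA : associative bip_mul.
Proof.
move=> x y z; move: x; apply: tensor_ext => [||b h]; first exact: bip_mul_bilin.1.
  by have [l r] := bip_mul_bilin; mlin; apply: (lin_bilinl z bip_mul_bilin).
move: y; apply: tensor_ext => [||c g].
- by apply: (lin_bilinr _ bip_mul_bilin); exact: bip_mul_bilin.1.
- by apply: (lin_bilinl _ bip_mul_bilin); exact: bip_mul_bilin.2.
move: z; apply: tensor_ext => [||d f].
- by apply: (lin_bilinr _ bip_mul_bilin); exact: bip_mul_bilin.2.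
- exact: bip_mul_bilin.2.
rewrite !bip_mulE.
rewrite (app_tsum _ _ (bip_mul_bilin.2 _)) (app_tsum _ _ (bip_mul_bilin.1 _)).
under eq_tsum => g1 g2.
  rewrite bip_mulE.
  under eq_tsum => h1 h2.
    rewrite yd_act_mul [_ * tsum _ _](app_tsum _ _ (lin_mulr _ (@lin_id _ _))).
    rewrite (app_tsum _ _ (lin_otl _ (@lin_id _ _))).
    over.
  rewrite comulAE; last by split; mlin.
  over.
apply: esym.
under eq_tsum => h1 h2.
  rewrite bip_mulE comulM (app_tsum _ _ (tsum_linear _)); last by mlin.
  under eq_tsum => y1 y2.
    rewrite (app_tsum _ _ (tsum_linear _)); last by mlin.
    under eq_tsum do (rewrite tsum_ot; last by mlin).
    over.
  rewrite exchange_tsum; over.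
rewrite exchange_tsum; apply: eq_tsum => g1 g2; apply: eq_tsum => x y.
by apply: eq_tsum => y1 y2; rewrite yd_actM !mulrA.
Qed.

Lemma bip_mul1x : left_id (1 \ot 1) bip_mul.
Proof.
apply: tensor_ext => [||b h]; [exact: bip_mul_bilin.2 | exact: lin_id |].
rewrite bip_mulE comul1 tsum_ot; last by mlin.
by rewrite yd_act1 !mul1r.
Qed.
Lemma bip_mulx1 : right_id (1 \ot 1) bip_mul.
Proof.
apply: tensor_ext => [||b h]; [exact: bip_mul_bilin.1 | exact: lin_id |].
rewrite bip_mulE -[in RHS](comul_counitl h) (app_tsum _ _ ((ot_bilin _ _).2 _)).
apply: eq_tsum => h1 h2; rewrite yd_act_one mulr1 -scalerAr mulr1.
by rewrite (scalable_linear ((ot_bilin _ _).1 _)) (scalable_linear ((ot_bilin _ _).2 _)).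
Qed.
Lemma bip_mulDl : left_distributive bip_mul +%R.
Proof. by move=> x y z; have := bip_mul_bilin.1 z 1 x y; rewrite !scale1r. Qed.
Lemma bip_mulDr : right_distributive bip_mul +%R.
Proof. by move=> x y z; have := bip_mul_bilin.2 x 1 y z; rewrite !scale1r. Qed.
Lemma bip_scalerAl (a : k) x y : a *: bip_mul x y = bip_mul (a *: x) y.
Proof. by rewrite (scalable_linear (bip_mul_bilin.1 y)). Qed.
Lemma bip_scalerAr (a : k) x y : a *: bip_mul x y = bip_mul x (a *: y).
Proof. by rewrite (scalable_linear (bip_mul_bilin.2 x)). Qed.
Lemma bip_oner_neq0 : (1 \ot 1 : tensor B H) != 0.
Proof.
apply/eqP => /(congr1 bip_counit); rewrite bip_counitE (yd_counit1 P) counit1 mulr1.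
have -> : bip_counit 0 = 0.
  have := scalable_linear bip_counit_linear 0 0; rewrite scale0r => e; rewrite e; exact: mul0r.
by move/eqP; rewrite oner_eq0.
Qed.

Lemma bip_counitl x : \sw_(y, z <- bip_comul x) (bip_counit y *: z) = x.
Proof.
have hc := bip_counit_linear; have hd := bip_comul_linear.
have hb : bilin (fun y z : tensor B H => bip_counit y *: z).
  by split=> [z|y]; [exact: lin_scalel | exact: (lin_scale _ (@lin_id _ _))].
move: x; apply: tensor_ext => [||b h]; [exact: lin_tsum_arg | exact: lin_id |].
rewrite bip_comulE (app_tsum _ _ (tsum_linear hb)).
under eq_tsum => b1 b2.
  rewrite (app_tsum _ _ (tsum_linear hb)).
  under eq_tsum => g c.
    rewrite (app_tsum _ _ (tsum_linear hb)).
    under eq_tsum => h1 h2.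
      rewrite tsum_ot // bip_counitE counitM mulrA -scalerA -ot_scale; over.
    rewrite -(app_tsum (g := fun z => (_ *: (_ \ot z)))); last by mlin.
    rewrite comul_counitl -scalerA scale_ot; over.
  rewrite -(app_tsum (g := fun z => (_ *: (z \ot _)))); last by mlin.
  rewrite yd_coact_counit scale_ot; over.
rewrite -(app_tsum (g := fun z => (z \ot _))); last by mlin.
by rewrite comul_counitl.
Qed.

Lemma bip_counitr x : \sw_(y, z <- bip_comul x) (bip_counit z *: y) = x.
Proof.
have hc := bip_counit_linear; have hd := bip_comul_linear.
have hb : bilin (fun y z : tensor B H => bip_counit z *: y).
  by split=> [z|y]; [exact: (lin_scale _ (@lin_id _ _)) | exact: lin_scalel].
move: x; apply: tensor_ext => [||b h]; [exact: lin_tsum_arg | exact: lin_id |].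
rewrite bip_comulE (app_tsum _ _ (tsum_linear hb)).
under eq_tsum => b1 b2.
  rewrite (app_tsum _ _ (tsum_linear hb)).
  under eq_tsum => g c.
    rewrite (app_tsum _ _ (tsum_linear hb)).
    under eq_tsum => h1 h2.
      rewrite tsum_ot // bip_counitE -scalerA -ot_scale scalerAr; over.
    rewrite -(app_tsum (g := fun z => (_ *: (_ \ot (_ * z))))); last by mlin.
    rewrite comul_counitr -ot_scale scalerAl; over.
  rewrite -(app_tsum (g := fun z => (_ \ot (z * _)))); last by mlin.
  rewrite yd_coact_counit_r -scalerAl mul1r ot_scale scale_ot; over.
rewrite -(app_tsum (g := fun z => (z \ot _))); last by mlin.
by rewrite comul_counitr.
Qed.

Lemma yd_coactAE (W : lmodType k) (F : H -> H -> B -> W) b : trilin F ->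
  \sw_(h, c <- rho b) \sw_(h1, h2 <- comul h) F h1 h2 c =
  \sw_(h, c <- rho b) \sw_(g, d <- rho c) F h g d.
Proof.
move=> hF; have hb := trilin_bilin hF.
have := congr1 (fun t => \sw_(u, s <- t) \sw_(v, x <- s) F u v x) (yd_coactA P b).
rewrite !(app_tsum _ _ (tsum_linear hb)).
under eq_tsum => x y.
  rewrite (app_tsum _ _ (tsum_linear hb)).
  under eq_tsum do rewrite tsum3 //.
  over.
by move=> ->; apply: eq_tsum => x y; rewrite tsum_ot.
Qed.

Lemma yd_coact_comulE (W : lmodType k) (F : H -> B -> B -> W) b : trilin F ->
  \sw_(h, c <- rho b) \sw_(c1, c2 <- comul c) F h c1 c2 =
  \sw_(b1, b2 <- comul b) \sw_(h, c1 <- rho b1) \sw_(g, c2 <- rho b2) F (h * g) c1 c2.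
Proof.
move=> hF; have hb := trilin_bilin hF.
have := congr1 (fun t => \sw_(u, s <- t) \sw_(v, x <- s) F u v x) (yd_coact_comul P b).
rewrite !(app_tsum _ _ (tsum_linear hb)).
under eq_tsum do rewrite tsum_ot //.
move=> ->; apply: eq_tsum => b1 b2.
rewrite (app_tsum _ _ (tsum_linear hb)); apply: eq_tsum => h c1.
rewrite (app_tsum _ _ (tsum_linear hb)); apply: eq_tsum => g c2.
exact: tsum3.
Qed.

Lemma bip_comulA x :
  \sw_(y, z <- bip_comul x) \sw_(y1, y2 <- bip_comul y) (y1 \ot (y2 \ot z)) =
  \sw_(y, z <- bip_comul x) (y \ot bip_comul z).
Proof.
have hd := bip_comul_linear.
pose f (y z : tensor B H) := \sw_(y1, y2 <- bip_comul y) (y1 \ot (y2 \ot z)).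
have hf : bilin f by rewrite /f; mlin.
have hb : bilin (fun y z : tensor B H => y \ot bip_comul z) by mlin.
pose T (u : B) (p : H) (d : B) (q : H) (c : B) (r : H) :=
  (u \ot p) \ot ((d \ot q) \ot (c \ot r)).
move: x; apply: tensor_ext => [||b h]; [exact: lin_tsum_arg | exact: lin_tsum_arg |].
rewrite bip_comulE (app_tsum _ _ (tsum_linear hb)) (app_tsum _ _ (tsum_linear hf)).
transitivity (\sw_(b1, b2 <- comul b) \sw_(u1, u2 <- comul b1)
    \sw_(g', d <- rho u2) \sw_(g, c <- rho b2) \sw_(g1, g2 <- comul g)
    \sw_(h1, h2 <- comul h) \sw_(r, s <- comul h1) T u1 (g' * (g1 * r)) d (g2 * s) c h2).
  apply: eq_tsum => b1 b2; rewrite (app_tsum _ _ (tsum_linear hf)).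
  under eq_tsum => g c.
    rewrite (app_tsum _ _ (tsum_linear hf)).
    under eq_tsum => h1 h2.
      rewrite tsum_ot // /f bip_comulE (app_tsum _ _ (tsum_linear _)); last by mlin.
      under eq_tsum => u1 u2.
        rewrite (app_tsum _ _ (tsum_linear _)); last by mlin.
        under eq_tsum => g' d.
          rewrite (app_tsum _ _ (tsum_linear _)); last by mlin.
          rewrite comulM (app_tsum _ _ (tsum_linear _)); last by mlin.
          under eq_tsum do (rewrite (app_tsum _ _ (tsum_linear _)); last by mlin).
          over.
        over.
      over.
    rewrite exchange_tsum; over.
  rewrite exchange_tsum; apply: eq_tsum => u1 u2.
  under eq_tsum => g c do rewrite exchange_tsum.
  rewrite exchange_tsum; apply: eq_tsum => g' d; apply: eq_tsum => g c.
  rewrite exchange_tsum; apply: eq_tsum => g1 g2; apply: eq_tsum => h1 h2.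
  apply: eq_tsum => r s; rewrite tsum_ot; last by mlin.
  by rewrite tsum_ot; last by mlin.
rewrite comulAE; last by split; rewrite /T; mlin.
apply: eq_tsum => b1 b2; rewrite (app_tsum _ _ (tsum_linear hb)).
transitivity (\sw_(g, c <- rho b2) \sw_(c1, c2 <- comul c) \sw_(g', d <- rho c2)
    \sw_(h1, h2 <- comul h) \sw_(p, q <- comul h2) T b1 (g * h1) c1 (g' * p) d q);
    last first.
  apply: eq_tsum => g c; rewrite (app_tsum _ _ (tsum_linear hb)).
  under [RHS]eq_tsum => h1 h2.
    rewrite tsum_ot // bip_comulE (app_tsum _ _ ((ot_bilin _ _).2 _)).
    under eq_tsum => c1 c2.
      rewrite (app_tsum _ _ ((ot_bilin _ _).2 _)).
      under eq_tsum => g' d do rewrite (app_tsum _ _ ((ot_bilin _ _).2 _)).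
      over.
    over.
  rewrite [RHS]exchange_tsum; apply: eq_tsum => c1 c2.
  by rewrite [RHS]exchange_tsum.
rewrite [RHS]yd_coact_comulE; last by split; rewrite /T; mlin.
apply: eq_tsum => x y; apply: eq_tsum => m x0.
rewrite -[RHS]yd_coactAE; last by split; rewrite /T; mlin.
apply: eq_tsum => n d; apply: eq_tsum => n1 n2.
rewrite comulAE; last by split; rewrite /T; mlin.
by apply: eq_tsum => h1 h2; apply: eq_tsum => p q; rewrite !mulrA.
Qed.

Definition biproduct_of (_ : admissible_pair H B) : Type := tensor B H.
Local Notation BxH := (biproduct_of P).

HB.instance Definition _ := GRing.Lmodule.on BxH.
HB.instance Definition _ := GRing.Zmodule_isNzRing.Build BxH
  bip_mulA bip_mul1x bip_mulx1 bip_mulDl bip_mulDr bip_oner_neq0.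
HB.instance Definition _ := GRing.Lmodule_isLalgebra.Build k BxH bip_scalerAl.
HB.instance Definition _ := GRing.Lalgebra_isAlgebra.Build k BxH bip_scalerAr.
HB.instance Definition _ := Lmodule_isCoalgebra.Build k BxH
  bip_comul_linear bip_counit_linear bip_comulA bip_counitl bip_counitr.

End Biproduct.

Definition biproduct (k : fieldType) (H : hopfAlgType k) (B : algCoalgType k)
  (P : admissible_pair H B) : algCoalgType k := biproduct_of P.

Section OrdinaryForms.
Variables (k : fieldType) (K : algCoalgType k).
Implicit Types s t : tensor K K -> k.

Definition normalized s : Prop :=
  forall x : K, s (1 \ot x) = counit x /\ s (x \ot 1) = counit x.

Definition conv s t (x y : K) : k :=
  \sw_(x1, x2 <- comul x) \sw_(y1, y2 <- comul y) (s (x1 \ot y1) * t (x2 \ot y2)).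

Definition conv_inverse s t : Prop := forall x y : K,
  conv s t x y = counit x * counit y /\ conv t s x y = counit x * counit y.

Definition normalized_invertible s t : Prop :=
  [/\ scalar s, scalar t, normalized s & conv_inverse s t].

(* The t below is the convolution inverse of s, which is unique. *)
Definition pure_form s : Prop := exists2 t, normalized_invertible s t &
  forall a b c d : K,
    \sw_(b1, b' <- comul b) \sw_(b2, b3 <- comul b')
    \sw_(c1, c' <- comul c) \sw_(c2, c3 <- comul c')
      (s (a * b1 \ot c1) * t (b2 \ot c2) * s (b3 \ot c3 * d)) =
    \sw_(b1, b' <- comul b) \sw_(b2, b3 <- comul b')
    \sw_(c1, c' <- comul c) \sw_(c2, c3 <- comul c')
      (s (b1 \ot c1 * d) * t (b2 \ot c2) * s (a * b3 \ot c3)).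

Definition neat_form s : Prop := (exists t, normalized_invertible s t) /\
  forall a b c : K,
    \sw_(b1, b2 <- comul b) (s (a \ot b1) * s (b2 \ot c)) =
    \sw_(b1, b2 <- comul b) (s (b1 \ot c) * s (a \ot b2)).

Definition lazy_form s : Prop := (exists t, normalized_invertible s t) /\
  forall x y : K,
    \sw_(x1, x2 <- comul x) \sw_(y1, y2 <- comul y) (s (x1 \ot y1) *: (x2 * y2)) =
    \sw_(x1, x2 <- comul x) \sw_(y1, y2 <- comul y) (s (x2 \ot y2) *: (x1 * y1)).

Definition cocycle_form s : Prop := (exists t, normalized_invertible s t) /\
  forall a b c : K,
    \sw_(a1, a2 <- comul a) \sw_(b1, b2 <- comul b)
      (s (a1 \ot b1) * s (a2 * b2 \ot c)) =
    \sw_(b1, b2 <- comul b) \sw_(c1, c2 <- comul c)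
      (s (b1 \ot c1) * s (a \ot b2 * c2)).

End OrdinaryForms.

Section YDForms.
Variables (k : fieldType) (H : hopfAlgType k) (B : algCoalgType k).
Variable P : admissible_pair H B.
Implicit Types s t : tensor B B -> k.
Local Notation "h \act b" := (yd_act P h b) (at level 38, right associativity).
Local Notation rho := (yd_coact P).

Definition yd_morphism s : Prop :=
  [/\ scalar s,
    forall (h : H) (b c : B),
      \sw_(h1, h2 <- comul h) s (h1 \act b \ot h2 \act c) = counit h * s (b \ot c) &
    forall b c : B,
      \sw_(g, b0 <- rho b) \sw_(f, c0 <- rho c) (s (b0 \ot c0) *: (g * f)) =
      s (b \ot c) *: 1].

Definition yd_conv s t (b c : B) : k :=
  \sw_(b1, b2 <- comul b) \sw_(g, b20 <- rho b2) \sw_(c1, c2 <- comul c)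
    (s (b1 \ot g \act c1) * t (b20 \ot c2)).

Definition yd_conv_inverse s t : Prop := forall b c : B,
  yd_conv s t b c = counit b * counit c /\ yd_conv t s b c = counit b * counit c.

Definition yd_normalized_invertible s t : Prop :=
  [/\ yd_morphism s, yd_morphism t, normalized s & yd_conv_inverse s t].

Definition yd_pure s : Prop := exists2 t, yd_normalized_invertible s t &
  forall a b c d : B,
    \sw_(b1, b2 <- comul b) \sw_(h, e <- rho b2)
    \sw_(e1, e2 <- comul e) \sw_(g, e20 <- rho e2)
    \sw_(c1, c' <- comul c) \sw_(c2, c3 <- comul c')
      (s (a * b1 \ot h \act c1) * t (e1 \ot g \act c2) * s (e20 \ot c3 * d)) =
    \sw_(b1, b2 <- comul b) \sw_(h, e <- rho b2)
    \sw_(e1, e2 <- comul e) \sw_(g, e20 <- rho e2) \sw_(f, e200 <- rho e20)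
    \sw_(c1, c' <- comul c) \sw_(c2, c3 <- comul c') \sw_(l, c30 <- rho c3)
      (s (b1 \ot (h \act c1) * ((f * l) \act d)) * t (e1 \ot g \act c2) *
       s (a * e200 \ot c30)).

Definition yd_neat s : Prop := (exists t, yd_normalized_invertible s t) /\
  forall a b c : B,
    \sw_(b1, b2 <- comul b) (s (a \ot b1) * s (b2 \ot c)) =
    \sw_(g, a0 <- rho a) \sw_(b1, b2 <- comul b)
      (s (g \act b1 \ot c) * s (a0 \ot b2)).

Definition yd_lazy s : Prop := (exists t, yd_normalized_invertible s t) /\
  forall b c : B,
    \sw_(b1, b2 <- comul b) \sw_(g, b20 <- rho b2) \sw_(c1, c2 <- comul c)
      (s (b1 \ot g \act c1) *: (b20 * c2)) =
    \sw_(b1, b2 <- comul b) \sw_(g, b20 <- rho b2) \sw_(c1, c2 <- comul c)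
      (s (b20 \ot c2) *: (b1 * (g \act c1))).

Definition yd_cocycle s : Prop := (exists t, yd_normalized_invertible s t) /\
  forall a b c : B,
    \sw_(a1, a2 <- comul a) \sw_(g, a20 <- rho a2) \sw_(b1, b2 <- comul b)
      (s (a1 \ot g \act b1) * s (a20 * b2 \ot c)) =
    \sw_(b1, b2 <- comul b) \sw_(g, b20 <- rho b2) \sw_(c1, c2 <- comul c)
      (s (b1 \ot g \act c1) * s (a \ot b20 * c2)).

Definition overline s (t : tensor (biproduct P) (biproduct P)) : k :=
  \sw_(x, y <- t) \sw_(b, h <- x : tensor B H) \sw_(b', h' <- y : tensor B H)
    (s (b \ot h \act b') * counit h').

Lemma biproduct_mulE (b c : B) (h g : H) :
  (b \ot h : biproduct P) * (c \ot g : biproduct P) =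
  \sw_(h1, h2 <- comul h) (b * (h1 \act c) \ot h2 * g).
Proof. exact: bip_mulE. Qed.

Lemma biproduct_comulE (b : B) (h : H) :
  comul (b \ot h : biproduct P) =
  \sw_(b1, b2 <- comul b) \sw_(g, c <- rho b2) \sw_(h1, h2 <- comul h)
    ((b1 \ot g * h1 : biproduct P) \ot (c \ot h2 : biproduct P)).
Proof. exact: bip_comulE. Qed.

Lemma biproduct_counitE (b : B) (h : H) :
  counit (b \ot h : biproduct P) = counit b * counit h :> k.
Proof. exact: bip_counitE. Qed.

Lemma biproduct_oneE : 1 = 1 \ot 1 :> biproduct P.
Proof. by []. Qed.

Lemma overlineE s b h b' h' : scalar s ->
  overline s ((b \ot h : biproduct P) \ot (b' \ot h' : biproduct P)) =
  s (b \ot h \act b') * counit h'.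
Proof.
move=> hs; have hl : linear (s : _ -> k^o) by [].
have lins (U : lmodType k) (f : U -> tensor B B) :
  linear f -> linear ((fun x => s (f x)) : U -> k^o) by exact: (lin_comp hl).
rewrite /overline (tsum_ot (W := k^o)); last by mlin; apply: lins; mlin.
rewrite (tsum_ot (W := k^o)); last by mlin; apply: lins; mlin.
by rewrite (tsum_ot (W := k^o)) //; mlin; apply: lins; mlin.
Qed.

End YDForms.

Arguments overline {k H B} P s t.

(* Main.v *)
(* Write i h = 1 x h. The form overline s is H-balanced: s(x i(h), y) = s(x, i(h) y),
   while s(i(h) x, y) and s(x, y i(h)) are both eps(h) s(x, y). Hence each side L of
   the identities to be checked satisfies L(.., x i(h), y, ..) = L(.., x, i(h) y, ..)
   and is right H-linear in its last argument; since B x H is spanned by the products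
   (b x 1) i(h), it suffices to evaluate at arguments b x 1. There the H-components of
   the iterated coproducts are absorbed by the counit or, for the right-hand sides of
   the lazy and pure identities, by the H-colinearity of s and of its inverse. For
   neat forms, linearity and colinearity give s(g.b, c) = s(b, S(g).c) and
   S(a^(-1)) s(a^(0), b) = b^(-1) s(a, b^(0)), which transfers the coaction from a
   to b_2. *)

Require Import Defs.
From HB Require Import structures.
From mathcomp Require Import all_boot all_algebra ring.

Set Implicit Arguments.
Unset Strict Implicit.
Unset Printing Implicit Defensive.

Import GRing.Theory.
Local Open Scope ring_scope.

(** * Sweedler calculus: threefold coproducts, linearity of sums, counit rules *)

Section TripleSum.
Variables (k : fieldType) (C : coalgType k).

(** The second leg is the one split again, as in [pure_form], so sums written with [sw3] are
    convertible to those of the definition. *)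
Definition sw3 (W : nmodType) (F : C -> C -> C -> W) (c : C) : W :=
  \sw_(c1, c' <- comul c) \sw_(c2, c3 <- comul c') F c1 c2 c3.

Lemma eq_sw3 (W : nmodType) (F G : C -> C -> C -> W) c :
  (forall x y z, F x y z = G x y z) -> sw3 F c = sw3 G c.
Proof. by move=> FG; do 2!apply: eq_tsum => ? ?; exact: FG. Qed.

Lemma lin_sw3 (U W : lmodType k) (F : U -> C -> C -> C -> W) c :
  (forall x y z, linear (fun u => F u x y z)) -> linear (fun u => sw3 (F u) c).
Proof. by move=> hF; rewrite /sw3; mlin; exact: hF. Qed.

Lemma lin_sw3_arg (U W : lmodType k) (F : C -> C -> C -> W) (f : U -> C) :
  trilin F -> linear f -> linear (fun u => sw3 F (f u)).
Proof. case=> h1 h2 h3 hf; rewrite /sw3; mlin; [exact: h1 | exact: h2 | exact: h3]. Qed.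

End TripleSum.

(** Restated with codomain [k^o], the form in which [lin] composes the counit with other linear
    maps. *)
Lemma counit_klinear (k : fieldType) (C : coalgType k) : linear (counit : C -> k^o).
Proof. exact: counit_linear. Qed.

(** Extends [mlin] by the linear, bilinear and trilinear maps assumed in the context and by [sw3];
    it discharges the side conditions of the Sweedler rewrites below. *)
Ltac lin := repeat first [progress mlin | intros; cbn beta; match goal with
  | |- trilin _ => split
  | hf : GRing.linear_for _ ?f |- GRing.linear_for _ ?f => exact: hf
  | hf : bilin ?f |- GRing.linear_for _ (?f _) => exact: hf.2
  | hf : trilin ?f |- GRing.linear_for _ (?f _ _) =>
      let h := fresh in have [_ _ h] := hf; exact: h
  | hf : GRing.linear_for _ ?f |- GRing.linear_for _ (fun x => ?f _) =>
      first [apply: (lin_comp (W := _^o) hf) | apply: (lin_comp hf)]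
  | hf : bilin ?f |- GRing.linear_for _ (fun x => ?f _ _) =>
      first [apply: (lin_bilinl _ hf) | apply: (lin_bilinr _ hf)]
  | hf : trilin ?f |- GRing.linear_for _ (fun x => ?f _ _ _) =>
      let h1 := fresh in let h2 := fresh in let h3 := fresh in
      have [h1 h2 h3] := hf;
      first [apply: (lin_comp (h1 _ _)) | apply: (lin_comp (h2 _ _))
            | apply: (lin_comp (h3 _ _))];
      clear h1 h2 h3
  | |- GRing.linear_for _ (fun x => @counit _ ?C _) =>
      apply: (lin_comp (W := _^o) (@counit_klinear _ C))
  | |- GRing.linear_for _ (fun x => sw3 _ _) => first [apply: lin_sw3_arg | apply: lin_sw3]
  end].

Section Sweedler.
Variable k : fieldType.

Lemma tsum_tsum (U V U' V' W : lmodType k) (F : U -> V -> W)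
    (G : U' -> V' -> tensor U V) t : bilin F ->
  tsum F (\sw_(u, v <- t) G u v) = \sw_(u, v <- t) tsum F (G u v).
Proof. by move=> hF; rewrite (app_tsum _ _ (tsum_linear hF)). Qed.

Variable C : coalgType k.

Lemma sw_counitl (W : lmodType k) (F : C -> W) c : linear F ->
  \sw_(x, y <- comul c) (counit x *: F y) = F c.
Proof.
move=> hF; rewrite -[in RHS](comul_counitl c) (app_tsum _ _ hF).
by apply: eq_tsum => x y; rewrite (scalable_linear hF).
Qed.

Lemma sw_counitr (W : lmodType k) (F : C -> W) c : linear F ->
  \sw_(x, y <- comul c) (counit y *: F x) = F c.
Proof.
move=> hF; rewrite -[in RHS](comul_counitr c) (app_tsum _ _ hF).
by apply: eq_tsum => x y; rewrite (scalable_linear hF).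
Qed.

Lemma sw3_scale (W : lmodType k) (a : k) (F : C -> C -> C -> W) c :
  sw3 (fun x y z => a *: F x y z) c = a *: sw3 F c.
Proof.
have la : linear ( *:%R a : W -> W) by exact: (lin_scale _ (@lin_id _ _)).
rewrite /sw3 (app_tsum _ _ la).
by apply: eq_tsum => x y; rewrite (app_tsum _ _ la).
Qed.

Lemma sw3_counitl (W : lmodType k) (F : C -> W) c : linear F ->
  sw3 (fun x y z => (counit x * counit y : k) *: F z) c = F c.
Proof.
move=> hF; rewrite -[RHS]sw_counitl //; apply: eq_tsum => x c'.
rewrite -[F c'](sw_counitl _ hF) (app_tsum _ _ (lin_scale _ (@lin_id _ _))).
by apply: eq_tsum => y z; rewrite scalerA.
Qed.

Lemma sw3_counitr (W : lmodType k) (F : C -> W) c : linear F ->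
  sw3 (fun x y z => (counit y * counit z : k) *: F x) c = F c.
Proof.
move=> hF; rewrite -[RHS]sw_counitr //; apply: eq_tsum => x c'.
have h : linear (fun y : C => (counit y : k) *: F x) by lin.
rewrite -(sw_counitr _ h); apply: eq_tsum => y z.
by rewrite scalerA mulrC.
Qed.

End Sweedler.

Lemma exchange_tsum3 (k : fieldType) (U V : lmodType k) (C : coalgType k) (W : nmodType)
    (F : U -> V -> C -> C -> C -> W) t c :
  \sw_(u, v <- t) sw3 (F u v) c = sw3 (fun x y z => \sw_(u, v <- t) F u v x y z) c.
Proof. by rewrite /sw3 exchange_tsum; apply: eq_tsum => x y; rewrite exchange_tsum. Qed.

Lemma exchange_sw3 (k : fieldType) (C D : coalgType k) (W : nmodType)
    (F : C -> C -> C -> D -> D -> D -> W) c d :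
  sw3 (fun x y z => sw3 (F x y z) d) c =
  sw3 (fun u v w => sw3 (fun x y z => F x y z u v w) c) d.
Proof.
rewrite /sw3; under eq_tsum => x y do rewrite exchange_tsum.
rewrite exchange_tsum; apply: eq_tsum => u v.
under eq_tsum => x y do rewrite exchange_tsum.
by rewrite exchange_tsum.
Qed.

(** * Balanced forms on an algebra and coalgebra with a map from H *)

Section Balanced.
Variables (k : fieldType) (H : hopfAlgType k) (K : algCoalgType k) (i : H -> K).
Hypothesis i_linear : linear i.
Hypothesis comulMi : forall x h, comul (x * i h) =
  \sw_(x1, x2 <- comul x) \sw_(h1, h2 <- comul h) (x1 * i h1 \ot x2 * i h2).
Hypothesis comuliM : forall x h, comul (i h * x) =
  \sw_(x1, x2 <- comul x) \sw_(h1, h2 <- comul h) (i h1 * x1 \ot i h2 * x2).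

Lemma sw_Mi (W : lmodType k) (F : K -> K -> W) x h : bilin F ->
  \sw_(y, z <- comul (x * i h)) F y z =
  \sw_(x1, x2 <- comul x) \sw_(h1, h2 <- comul h) F (x1 * i h1) (x2 * i h2).
Proof.
move=> hF; rewrite comulMi tsum_tsum //; apply: eq_tsum => x1 x2.
by rewrite tsum_tsum //; apply: eq_tsum => h1 h2; rewrite tsum_ot.
Qed.

Lemma sw_iM (W : lmodType k) (F : K -> K -> W) x h : bilin F ->
  \sw_(y, z <- comul (i h * x)) F y z =
  \sw_(x1, x2 <- comul x) \sw_(h1, h2 <- comul h) F (i h1 * x1) (i h2 * x2).
Proof.
move=> hF; rewrite comuliM tsum_tsum //; apply: eq_tsum => x1 x2.
by rewrite tsum_tsum //; apply: eq_tsum => h1 h2; rewrite tsum_ot.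
Qed.

Lemma sw3_Mi (W : lmodType k) (F : K -> K -> K -> W) x h : trilin F ->
  sw3 F (x * i h) =
  sw3 (fun x1 x2 x3 => sw3 (fun h1 h2 h3 => F (x1 * i h1) (x2 * i h2) (x3 * i h3)) h) x.
Proof.
move=> hF; rewrite /sw3 sw_Mi; last by lin.
apply: eq_tsum => x1 x'; rewrite [RHS]exchange_tsum; apply: eq_tsum => h1 h'.
by rewrite sw_Mi //; lin.
Qed.

Lemma sw3_iM (W : lmodType k) (F : K -> K -> K -> W) x h : trilin F ->
  sw3 F (i h * x) =
  sw3 (fun x1 x2 x3 => sw3 (fun h1 h2 h3 => F (i h1 * x1) (i h2 * x2) (i h3 * x3)) h) x.
Proof.
move=> hF; rewrite /sw3 sw_iM; last by lin.
apply: eq_tsum => x1 x'; rewrite [RHS]exchange_tsum; apply: eq_tsum => h1 h'.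
by rewrite sw_iM //; lin.
Qed.

Hypothesis counitMi : forall x h, counit (x * i h) = counit x * counit h :> k.
Hypothesis counitiM : forall h x, counit (i h * x) = counit h * counit x :> k.

Definition balanced (s : tensor K K -> k) : Prop :=
  [/\ scalar s, forall x h y, s (x * i h \ot y) = s (x \ot i h * y),
      forall x y h, s (x \ot y * i h) = counit h * s (x \ot y) &
      forall h x y, s (i h * x \ot y) = counit h * s (x \ot y)].

Variables (B : Type) (j : B -> K).
Hypothesis jiP : forall (W : lmodType k) (f g : K -> W), linear f -> linear g ->
  (forall b h, f (j b * i h) = g (j b * i h)) -> f =1 g.

(** Serves the last argument of an identity: a right factor [i h] there changes both sides in the
    same way, by the scalar [counit h] or, for lazy forms, by right multiplication. *)
Lemma eq_on_j (W : lmodType k) (f g : K -> W) : linear f -> linear g ->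
  (forall x h, f x = g x -> f (x * i h) = g (x * i h)) ->
  (forall b, f (j b) = g (j b)) -> f =1 g.
Proof. by move=> hf hg fgi fgj; apply: jiP => // b h; apply: fgi. Qed.

(** The factor [i h] of the first argument is handed to the second, which stays arbitrary. Applied
    slot by slot from left to right, this pushes all such factors into the last argument. *)
Lemma eq_balanced (W : lmodType k) (f g : K -> K -> W) :
  (forall y, linear (f^~ y)) -> (forall y, linear (g^~ y)) ->
  (forall x h y, f (x * i h) y = f x (i h * y)) ->
  (forall x h y, g (x * i h) y = g x (i h * y)) ->
  (forall b y, f (j b) y = g (j b) y) -> forall x y, f x y = g x y.
Proof.
move=> hf hg fi gi fg x y; move: x; apply: jiP (hf y) (hg y) _ => b h.
by rewrite fi gi fg.
Qed.

(** * Reduction of the defining identities to arguments [j b] *)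

Section Forms.
Variables s t : tensor K K -> k.
Hypotheses (bs : balanced s) (bt : balanced t).

(** The codomain is [k^o] so that the rules for sums in modules apply to scalars. *)
Definition pure_lhs (a b c d : K) : k^o := sw3 (fun b1 b2 b3 => sw3 (fun c1 c2 c3 =>
  s (a * b1 \ot c1) * t (b2 \ot c2) * s (b3 \ot c3 * d)) c) b.
Definition pure_rhs (a b c d : K) : k^o := sw3 (fun b1 b2 b3 => sw3 (fun c1 c2 c3 =>
  s (b1 \ot c1 * d) * t (b2 \ot c2) * s (a * b3 \ot c3)) c) b.

(** A factor [i h] travels from [a] through [b] and [c] to [d]. From [b] to [c] each of the three
    forms moves its own component of the threefold coproduct of [h]. In the passages from [a] to [b]
    and from [c] to [d], two components become counits and the third sits in the form containing
    [a], respectively [d]. At [d] both sides scale by [counit h]. *)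
Lemma pure_balanced :
  (forall a b c d, pure_lhs (j a) (j b) (j c) (j d) =
                   pure_rhs (j a) (j b) (j c) (j d)) ->
  forall a b c d, pure_lhs a b c d = pure_rhs a b c d.
Proof.
have [hs s_bal s_r s_l] := bs; have [ht t_bal t_r t_l] := bt.
move=> E a b c d; move: a b.
apply: (eq_balanced (W := k^o)) => [b|b|a h b|a h b|a b].
- by rewrite /pure_lhs; lin.
- by rewrite /pure_rhs; lin.
- rewrite /pure_lhs (sw3_iM (W := k^o)); last by lin.
  apply: eq_sw3 => b1 b2 b3.
  rewrite -[LHS](sw3_counitr (F := fun h => sw3 (fun c1 c2 c3 =>
    s (a * i h * b1 \ot c1) * t (b2 \ot c2) * s (b3 \ot c3 * d)) c : k^o)); last by lin.
  apply: eq_sw3 => h1 h2 h3; rewrite -sw3_scale; apply: eq_sw3 => c1 c2 c3.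
  by rewrite t_l s_l /GRing.scale /= !mulrA; ring.
- rewrite /pure_rhs (sw3_iM (W := k^o)); last by lin.
  apply: eq_sw3 => b1 b2 b3.
  rewrite -[LHS](sw3_counitl (F := fun h => sw3 (fun c1 c2 c3 =>
    s (b1 \ot c1 * d) * t (b2 \ot c2) * s (a * i h * b3 \ot c3)) c : k^o)); last by lin.
  apply: eq_sw3 => h1 h2 h3; rewrite -sw3_scale; apply: eq_sw3 => c1 c2 c3.
  by rewrite t_l s_l /GRing.scale /= !mulrA; ring.
move: b c.
apply: (eq_balanced (W := k^o)) => [c|c|b h c|b h c|b c].
- by rewrite /pure_lhs; lin.
- by rewrite /pure_rhs; lin.
- rewrite /pure_lhs (sw3_Mi (W := k^o)); last by lin.
  apply: eq_sw3 => b1 b2 b3; rewrite (sw3_iM (W := k^o)); last by lin.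
  rewrite exchange_sw3; do 2!apply: eq_sw3 => ? ? ?.
  by rewrite mulrA !s_bal t_bal mulrA.
- rewrite /pure_rhs (sw3_Mi (W := k^o)); last by lin.
  apply: eq_sw3 => b1 b2 b3; rewrite (sw3_iM (W := k^o)); last by lin.
  rewrite exchange_sw3; do 2!apply: eq_sw3 => ? ? ?.
  by rewrite mulrA !s_bal t_bal mulrA.
move: c d; apply: (eq_balanced (W := k^o)) => [d|d|c h d|c h d|c].
- by rewrite /pure_lhs; lin.
- by rewrite /pure_rhs; lin.
- rewrite /pure_lhs; apply: eq_sw3 => b1 b2 b3.
  rewrite (sw3_Mi (W := k^o)); last by lin.
  apply: eq_sw3 => c1 c2 c3.
  rewrite -[RHS](sw3_counitl (F := fun h =>
    s (j a * b1 \ot c1) * t (b2 \ot c2) * s (b3 \ot c3 * (i h * d)) : k^o)); last by lin.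
  apply: eq_sw3 => h1 h2 h3.
  by rewrite t_r s_r /GRing.scale /= !mulrA; ring.
- rewrite /pure_rhs; apply: eq_sw3 => b1 b2 b3.
  rewrite (sw3_Mi (W := k^o)); last by lin.
  apply: eq_sw3 => c1 c2 c3.
  rewrite -[RHS](sw3_counitr (F := fun h =>
    s (b1 \ot c1 * (i h * d)) * t (b2 \ot c2) * s (j a * b3 \ot c3) : k^o)); last by lin.
  apply: eq_sw3 => h1 h2 h3.
  by rewrite t_r s_r /GRing.scale /= !mulrA; ring.
apply: (eq_on_j (W := k^o)) => [||d h e|d].
- by rewrite /pure_lhs; lin.
- by rewrite /pure_rhs; lin.
- have -> : pure_lhs (j a) (j b) (j c) (d * i h) =
             counit h *: pure_lhs (j a) (j b) (j c) d.
    rewrite /pure_lhs -sw3_scale; apply: eq_sw3 => b1 b2 b3.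
    rewrite -sw3_scale; apply: eq_sw3 => c1 c2 c3.
    by rewrite mulrA s_r /GRing.scale /=; ring.
  rewrite e /pure_rhs -sw3_scale; apply: eq_sw3 => b1 b2 b3.
  rewrite -sw3_scale; apply: eq_sw3 => c1 c2 c3.
  by rewrite [c1 * (_ * i h)]mulrA s_r /GRing.scale /=; ring.
exact: E.
Qed.
Lemma conv_balanced :
  (forall a b, conv s t (j a) (j b) = counit (j a) * counit (j b)) ->
  forall a b, conv s t a b = counit a * counit b.
Proof.
have [hs s_bal s_r s_l] := bs; have [ht t_bal t_r t_l] := bt.
move=> E; rewrite /conv in E *.
apply: (eq_balanced (W := k^o)) => [b|b|a h b|a h b|a b].
- by lin.
- by lin.
- rewrite (sw_Mi (W := k^o)); last by lin.
  apply: eq_tsum => a1 a2; rewrite [RHS](sw_iM (W := k^o)); last by lin.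
  rewrite [RHS]exchange_tsum; do 2!apply: eq_tsum => ? ?.
  by rewrite s_bal t_bal.
- by rewrite counitMi counitiM; ring.
move: b; apply: (eq_on_j (W := k^o)) => [||b h e|b].
- by lin.
- by lin.
- rewrite counitMi mulrA -e mulrC -[RHS]/(counit h *: (_ : k^o)).
  rewrite (app_tsum (W := k^o) _ _ (lin_scale _ (@lin_id _ _))).
  apply: eq_tsum => a1 a2; rewrite (sw_Mi (W := k^o)); last by lin.
  rewrite (app_tsum (W := k^o) _ _ (lin_scale _ (@lin_id _ _))).
  apply: eq_tsum => b1 b2.
  (* Both forms turn their component of [h] into a counit: one is removed by the counit axiom, and
     the other is the scalar kept inside [F]. *)
  rewrite -[RHS](sw_counitl (F := fun h => counit h *: (s (a1 \ot b1) * t (a2 \ot b2) : k^o)));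
    last by lin.
  by apply: eq_tsum => h1 h2; rewrite s_r t_r /GRing.scale /=; ring.
exact: E.
Qed.

Definition neat_lhs (a b c : K) : k^o :=
  \sw_(b1, b2 <- comul b) (s (a \ot b1) * s (b2 \ot c)).
Definition neat_rhs (a b c : K) : k^o :=
  \sw_(b1, b2 <- comul b) (s (b1 \ot c) * s (a \ot b2)).

Lemma neat_balanced :
  (forall a b c, neat_lhs (j a) (j b) (j c) = neat_rhs (j a) (j b) (j c)) ->
  forall a b c, neat_lhs a b c = neat_rhs a b c.
Proof.
have [hs s_bal s_r s_l] := bs.
move=> E a b c; move: a b; apply: (eq_balanced (W := k^o)) => [b|b|a h b|a h b|a b].
- by rewrite /neat_lhs; lin.
- by rewrite /neat_rhs; lin.
- rewrite /neat_lhs (sw_iM (W := k^o)); last by lin.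
  apply: eq_tsum => b1 b2.
  rewrite -[LHS](sw_counitr (F := fun h => s (a * i h \ot b1) * s (b2 \ot c) : k^o));
    last by lin.
  by apply: eq_tsum => h1 h2; rewrite s_l s_bal /GRing.scale /=; ring.
- rewrite /neat_rhs (sw_iM (W := k^o)); last by lin.
  apply: eq_tsum => b1 b2.
  rewrite -[LHS](sw_counitl (F := fun h => s (b1 \ot c) * s (a * i h \ot b2) : k^o));
    last by lin.
  by apply: eq_tsum => h1 h2; rewrite s_l s_bal /GRing.scale /=; ring.
move: b c; apply: (eq_balanced (W := k^o)) => [c|c|b h c|b h c|b].
- by rewrite /neat_lhs; lin.
- by rewrite /neat_rhs; lin.
- rewrite /neat_lhs (sw_Mi (W := k^o)); last by lin.
  apply: eq_tsum => b1 b2.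
  rewrite -[RHS](sw_counitl (F := fun h => s (j a \ot b1) * s (b2 \ot i h * c) : k^o));
    last by lin.
  by apply: eq_tsum => h1 h2; rewrite s_r s_bal /GRing.scale /=; ring.
- rewrite /neat_rhs (sw_Mi (W := k^o)); last by lin.
  apply: eq_tsum => b1 b2.
  rewrite -[RHS](sw_counitr (F := fun h => s (b1 \ot i h * c) * s (j a \ot b2) : k^o));
    last by lin.
  by apply: eq_tsum => h1 h2; rewrite s_r s_bal /GRing.scale /=; ring.
apply: (eq_on_j (W := k^o)) => [||c h e|c].
- by rewrite /neat_lhs; lin.
- by rewrite /neat_rhs; lin.
- have -> : neat_lhs (j a) (j b) (c * i h) = counit h *: neat_lhs (j a) (j b) c.
    rewrite /neat_lhs (app_tsum (W := k^o) _ _ (lin_scale _ (@lin_id _ _))).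
    by apply: eq_tsum => b1 b2; rewrite s_r /GRing.scale /=; ring.
  rewrite e /neat_rhs (app_tsum (W := k^o) _ _ (lin_scale _ (@lin_id _ _))).
  by apply: eq_tsum => b1 b2; rewrite s_r /GRing.scale /=; ring.
exact: E.
Qed.

Definition lazy_lhs (x y : K) : K :=
  \sw_(x1, x2 <- comul x) \sw_(y1, y2 <- comul y) (s (x1 \ot y1) *: (x2 * y2)).
Definition lazy_rhs (x y : K) : K :=
  \sw_(x1, x2 <- comul x) \sw_(y1, y2 <- comul y) (s (x2 \ot y2) *: (x1 * y1)).

(** Here the sides take values in [K]. For the last argument, one component of [h] is killed by the
    form and the other survives as a right factor, so both sides are right linear over the image of
    [i]. *)
Lemma lazy_balanced :
  (forall x y, lazy_lhs (j x) (j y) = lazy_rhs (j x) (j y)) ->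
  forall x y, lazy_lhs x y = lazy_rhs x y.
Proof.
have [hs s_bal s_r s_l] := bs.
move=> E; apply: eq_balanced => [y|y|x h y|x h y|x y].
- by rewrite /lazy_lhs; lin.
- by rewrite /lazy_rhs; lin.
- rewrite /lazy_lhs sw_Mi; last by lin.
  apply: eq_tsum => x1 x2; rewrite [RHS]sw_iM; last by lin.
  rewrite [RHS]exchange_tsum; do 2!apply: eq_tsum => ? ?.
  by rewrite s_bal mulrA.
- rewrite /lazy_rhs sw_Mi; last by lin.
  apply: eq_tsum => x1 x2; rewrite [RHS]sw_iM; last by lin.
  rewrite [RHS]exchange_tsum; do 2!apply: eq_tsum => ? ?.
  by rewrite s_bal mulrA.
move: y; apply: eq_on_j => [||y h e|y].
- by rewrite /lazy_lhs; lin.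
- by rewrite /lazy_rhs; lin.
- have -> : lazy_lhs (j x) (y * i h) = lazy_lhs (j x) y * i h.
    rewrite /lazy_lhs (app_tsum _ _ (lin_mull _ (@lin_id _ _))).
    apply: eq_tsum => x1 x2; rewrite sw_Mi; last by lin.
    rewrite (app_tsum _ _ (lin_mull _ (@lin_id _ _))); apply: eq_tsum => y1 y2.
    rewrite -[RHS](sw_counitl (F := fun h => (s (x1 \ot y1) *: (x2 * y2)) * i h));
      last by lin.
    by apply: eq_tsum => h1 h2; rewrite s_r -scalerA mulrA scalerAl.
  rewrite e /lazy_rhs (app_tsum _ _ (lin_mull _ (@lin_id _ _))).
  apply: eq_tsum => x1 x2; rewrite [RHS]sw_Mi; last by lin.
  rewrite (app_tsum _ _ (lin_mull _ (@lin_id _ _))); apply: eq_tsum => y1 y2.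
  rewrite -[LHS](sw_counitr (F := fun h => (s (x2 \ot y2) *: (x1 * y1)) * i h));
    last by lin.
  by apply: eq_tsum => h1 h2; rewrite s_r -scalerA mulrA -scalerAl.
exact: E.
Qed.

Definition cocycle_lhs (a b c : K) : k^o :=
  \sw_(a1, a2 <- comul a) \sw_(b1, b2 <- comul b) (s (a1 \ot b1) * s (a2 * b2 \ot c)).
Definition cocycle_rhs (a b c : K) : k^o :=
  \sw_(b1, b2 <- comul b) \sw_(c1, c2 <- comul c) (s (b1 \ot c1) * s (a \ot b2 * c2)).

(** On the left, [i h] passes from [a] to [b] through both forms and from [b] to [c] through the
    second only; on the right it is the other way round. In the last slot each side scales by
    [counit h]. *)
Lemma cocycle_balanced :
  (forall a b c, cocycle_lhs (j a) (j b) (j c) = cocycle_rhs (j a) (j b) (j c)) ->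
  forall a b c, cocycle_lhs a b c = cocycle_rhs a b c.
Proof.
have [hs s_bal s_r s_l] := bs.
move=> E a b c; move: a b; apply: (eq_balanced (W := k^o)) => [b|b|a h b|a h b|a b].
- by rewrite /cocycle_lhs; lin.
- by rewrite /cocycle_rhs; lin.
- rewrite /cocycle_lhs (sw_Mi (W := k^o)); last by lin.
  apply: eq_tsum => a1 a2; rewrite [RHS](sw_iM (W := k^o)); last by lin.
  rewrite [RHS]exchange_tsum; do 2!apply: eq_tsum => ? ?.
  by rewrite s_bal mulrA.
- rewrite /cocycle_rhs (sw_iM (W := k^o)); last by lin.
  apply: eq_tsum => b1 b2; rewrite exchange_tsum; apply: eq_tsum => c1 c2.
  rewrite -[LHS](sw_counitl (F := fun h => s (b1 \ot c1) * s (a * i h \ot b2 * c2) : k^o));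
    last by lin.
  by apply: eq_tsum => h1 h2; rewrite s_l s_bal /GRing.scale /= !mulrA; ring.
move: b c; apply: (eq_balanced (W := k^o)) => [c|c|b h c|b h c|b].
- by rewrite /cocycle_lhs; lin.
- by rewrite /cocycle_rhs; lin.
- rewrite /cocycle_lhs; apply: eq_tsum => a1 a2.
  rewrite (sw_Mi (W := k^o)); last by lin.
  apply: eq_tsum => b1 b2.
  rewrite -[RHS](sw_counitl (F := fun h => s (a1 \ot b1) * s (a2 * b2 \ot i h * c) : k^o));
    last by lin.
  by apply: eq_tsum => h1 h2; rewrite s_r mulrA s_bal /GRing.scale /=; ring.
- rewrite /cocycle_rhs (sw_Mi (W := k^o)); last by lin.
  apply: eq_tsum => b1 b2; rewrite [RHS](sw_iM (W := k^o)); last by lin.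
  rewrite [RHS]exchange_tsum; do 2!apply: eq_tsum => ? ?.
  by rewrite s_bal mulrA.
apply: (eq_on_j (W := k^o)) => [||c h e|c].
- by rewrite /cocycle_lhs; lin.
- by rewrite /cocycle_rhs; lin.
- have -> : cocycle_lhs (j a) (j b) (c * i h) = counit h *: cocycle_lhs (j a) (j b) c.
    rewrite /cocycle_lhs (app_tsum (W := k^o) _ _ (lin_scale _ (@lin_id _ _))).
    apply: eq_tsum => a1 a2.
    rewrite (app_tsum (W := k^o) _ _ (lin_scale _ (@lin_id _ _))).
    by apply: eq_tsum => b1 b2; rewrite s_r /GRing.scale /=; ring.
  rewrite e /cocycle_rhs (app_tsum (W := k^o) _ _ (lin_scale _ (@lin_id _ _))).
  apply: eq_tsum => b1 b2; rewrite [RHS](sw_Mi (W := k^o)); last by lin.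
  rewrite (app_tsum (W := k^o) _ _ (lin_scale _ (@lin_id _ _))).
  apply: eq_tsum => c1 c2.
  rewrite -[LHS](sw_counitl (F := fun h =>
      counit h *: (s (b1 \ot c1) * s (j a \ot b2 * c2) : k^o))); last by lin.
  by apply: eq_tsum => h1 h2; rewrite s_r mulrA s_r /GRing.scale /=; ring.
exact: E.
Qed.
End Forms.

End Balanced.

(** * Consequences of H-linearity and H-colinearity for forms on B *)

Section YetterDrinfeldForms.
Variables (k : fieldType) (H : hopfAlgType k) (B : algCoalgType k).
Variable P : admissible_pair H B.
Local Notation "h \act b" := (yd_act P h b) (at level 38, right associativity).
Local Notation rho := (yd_coact P).

Lemma sw_coact_counit (W : lmodType k) (F : B -> W) b : linear F ->
  \sw_(h, c <- rho b) (counit h *: F c) = F b.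
Proof.
move=> hF; rewrite -[in RHS](yd_coact_counit P b) (app_tsum _ _ hF).
by apply: eq_tsum => h c; rewrite (scalable_linear hF).
Qed.

Lemma yd_compatE (W : lmodType k) (F : H -> B -> W) h b : bilin F ->
  \sw_(h1, h2 <- comul h) \sw_(g, c <- rho (h1 \act b)) F (g * h2) c =
  \sw_(h1, h2 <- comul h) \sw_(g, c <- rho b) F (h1 * g) (h2 \act c).
Proof.
move=> hF; have := congr1 (tsum F) (yd_compat P h b).
rewrite !tsum_tsum //.
under eq_tsum => h1 h2.
  rewrite tsum_tsum //; under eq_tsum do rewrite tsum_ot //.
  over.
move=> ->; apply: eq_tsum => h1 h2.
by rewrite tsum_tsum //; apply: eq_tsum => g c; rewrite tsum_ot.
Qed.

(** The nested sum is the one produced by the threefold coproduct of $b\times 1$. When its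
    H-components enter through counits only, it collapses to the threefold coproduct of [B]. *)
Lemma sw3_coact_counit (W : lmodType k) (F : B -> B -> B -> W) b : trilin F ->
  \sw_(b1, b2 <- comul b) \sw_(h, e <- rho b2) \sw_(e1, e2 <- comul e)
    \sw_(g, e20 <- rho e2) ((counit h * counit g : k) *: F b1 e1 e20) = sw3 F b.
Proof.
move=> hF; apply: eq_tsum => b1 b2.
rewrite -(sw_coact_counit (F := fun b => \sw_(e1, e2 <- comul b) F b1 e1 e2)); last by lin.
apply: eq_tsum => h e; rewrite (app_tsum _ _ (lin_scale _ (@lin_id _ _))).
apply: eq_tsum => e1 e2; rewrite -(sw_coact_counit (F := fun b => F b1 e1 b)); last by lin.
rewrite (app_tsum _ _ (lin_scale _ (@lin_id _ _))).
by apply: eq_tsum => g e20; rewrite scalerA.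
Qed.

Variable s : tensor B B -> k.
Hypothesis s_yd : yd_morphism P s.

Lemma yd_colinearE (W : lmodType k) (Z : H -> W) b c : linear Z ->
  \sw_(g, b0 <- rho b) \sw_(f, c0 <- rho c) (s (b0 \ot c0) *: Z (g * f)) =
  s (b \ot c) *: Z 1.
Proof.
have [hs _ s_col] := s_yd; move=> hZ.
rewrite -(scalable_linear hZ) -s_col (app_tsum _ _ hZ); apply: eq_tsum => g b0.
by rewrite (app_tsum _ _ hZ); apply: eq_tsum => f c0; rewrite (scalable_linear hZ).
Qed.

(** Insert $g_2S(g_3)$ in front of [c], then apply the H-invariance of [s] to $g_1$ and $g_2$. *)
Lemma yd_act_antipode g b c : s (g \act b \ot c) = s (b \ot antipode g \act c).
Proof.
have [hs s_inv _] := s_yd; have hS := @antipode_linear k H.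
rewrite -[LHS](sw_counitr (F := fun h => s (h \act b \ot c) : k^o)); last by lin.
rewrite -[RHS](sw_counitl (F := fun h => s (b \ot antipode h \act c) : k^o)); last by lin.
transitivity (\sw_(g1, g2 <- comul g) \sw_(h1, h2 <- comul g2)
    (s (g1 \act b \ot h1 \act antipode h2 \act c) : k^o)).
  apply: eq_tsum => g1 g2; pose Z x : k^o := s (g1 \act b \ot x \act c).
  have hZ : linear Z by rewrite /Z; lin.
  rewrite -[c in LHS](yd_act1 P) -[LHS]/(counit g2 *: Z 1) -(scalable_linear hZ).
  rewrite -antipoder (app_tsum _ _ hZ); apply: eq_tsum => h1 h2.
  by rewrite /Z yd_actM.
rewrite -(comulAE (W := k^o)); last by lin.
by apply: eq_tsum => g1 g2; rewrite s_inv.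
Qed.

(** Colinearity lets one insert $a^{(0)(-1)}b^{(-1)}$ to the right of $S(a^{(-1)})$. Coassociativity
    of the coaction then produces $S(g_1)g_2$ with $g=a^{(-1)}$, which is a counit, leaving only
    $b^{(-1)}$. *)
Lemma yd_colinear_antipode (W : lmodType k) (Z : H -> W) a b : linear Z ->
  \sw_(g, a0 <- rho a) (s (a0 \ot b) *: Z (antipode g)) =
  \sw_(h, b0 <- rho b) (s (a \ot b0) *: Z h).
Proof.
have [hs _ _] := s_yd; have hS := @antipode_linear k H; move=> hZ.
transitivity (\sw_(g, a0 <- rho a) \sw_(f, a00 <- rho a0) \sw_(h, b0 <- rho b)
   (s (a00 \ot b0) *: Z (antipode g * (f * h)))).
  apply: eq_tsum => g a0; rewrite -[antipode g in LHS]mulr1.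
  by rewrite -(yd_colinearE _ _ (Z := fun x => Z (antipode g * x))) //; lin.
rewrite -yd_coactAE; last by lin.
rewrite -[RHS](sw_coact_counit (F := fun a => \sw_(h, b0 <- rho b) (s (a \ot b0) *: Z h)));
  last by lin.
apply: eq_tsum => g a0; rewrite exchange_tsum.
rewrite (app_tsum _ _ (lin_scale _ (@lin_id _ _))); apply: eq_tsum => h b0.
rewrite scalerA mulrC -scalerA.
rewrite -(scalable_linear hZ).
have -> : counit g *: h = (\sw_(g1, g2 <- comul g) (antipode g1 * g2)) * h.
  by rewrite antipodel -scalerAl mul1r.
rewrite (app_tsum _ _ (lin_mull _ (@lin_id _ _))) (app_tsum _ _ hZ).
rewrite (app_tsum _ _ (lin_scale _ (@lin_id _ _))).
by apply: eq_tsum => g1 g2; rewrite mulrA.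
Qed.

(* Coassociativity turns h2 into e1^(-1) g1, with g1 and g2 from the coaction on e2;
   the Yetter-Drinfeld condition rewrites g1 m as (g1.c)^(-1) g2, and colinearity
   of s absorbs e1^(-1) (g1.c)^(-1). *)
Lemma yd_pure_core (W : lmodType k) (X : H -> H -> B -> W) b c : trilin X ->
  \sw_(h, e <- rho b) \sw_(e1, e2 <- comul e) \sw_(g, e20 <- rho e2)
    \sw_(f, e200 <- rho e20) (s (e1 \ot g \act c) *: X h f e200) =
  \sw_(h, e <- rho b) \sw_(h1, h2 <- comul h) \sw_(e1, e2 <- comul e)
    \sw_(g, e20 <- rho e2) \sw_(m, c0 <- rho c)
    (s (e1 \ot g \act c0) *: X h1 (h2 * m) e20).
Proof.
have [hs _ _] := s_yd; move=> hX.
rewrite [RHS]yd_coactAE; last by lin.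
apply: eq_tsum => h e; rewrite [RHS]yd_coact_comulE; last by lin.
apply: eq_tsum => e1 e2; rewrite -yd_coactAE; last by lin.
under [RHS]eq_tsum => q1 e10.
  rewrite -yd_coactAE; last by lin.
  over.
rewrite [RHS]exchange_tsum; apply: eq_tsum => g e20.
under [RHS]eq_tsum => q1 e10.
  under eq_tsum => g1 g2 do under eq_tsum => m c0 do rewrite -mulrA.
  rewrite -(yd_compatE _ _ (F := fun x c => s (e10 \ot c) *: X h (q1 * x) e20)); last by lin.
  over.
rewrite [RHS]exchange_tsum; apply: eq_tsum => g1 g2.
rewrite -[g2 in LHS]mul1r -(yd_colinearE _ _ (Z := fun x => X h (x * g2) e20)); last by lin.
by do 2!apply: eq_tsum => ? ?; rewrite mulrA.
Qed.

End YetterDrinfeldForms.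

(** * The biproduct, abstractly: its coproduct and the forms induced from B *)

Section Biproduct.
Variables (k : fieldType) (H : hopfAlgType k) (B : algCoalgType k).
Variable P : admissible_pair H B.
Local Notation "h \act b" := (yd_act P h b) (at level 38, right associativity).
Local Notation rho := (yd_coact P).

(* K stands for the biproduct and [bip b h] for b x h; keeping K abstract stops
   unification from unfolding it to a tensor product. *)
Variables (K : algCoalgType k) (bip : B -> H -> K).
Hypothesis bip_bilin : bilin bip.
Hypothesis bip_ext : forall (W : lmodType k) (f g : K -> W), linear f -> linear g ->
  (forall b h, f (bip b h) = g (bip b h)) -> f =1 g.
Hypothesis bip_mul : forall b h c g, bip b h * bip c g =
  \sw_(h1, h2 <- comul h) bip (b * h1 \act c) (h2 * g).
Hypothesis bip_comul : forall b h, comul (bip b h) =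
  \sw_(b1, b2 <- comul b) \sw_(g, c <- rho b2) \sw_(h1, h2 <- comul h)
    (bip b1 (g * h1) \ot bip c h2).
Hypothesis bip_counit : forall b h, counit (bip b h) = counit b * counit h :> k.
Hypothesis bip_one : bip 1 1 = 1.

Lemma bipMi b h g : bip b h * bip 1 g = bip b (h * g).
Proof.
rewrite bip_mul -[RHS](sw_counitl (F := fun h => bip b (h * g))); last by lin.
apply: eq_tsum => h1 h2; rewrite yd_act_one -scalerAr mulr1.
by rewrite (scalable_linear (bip_bilin.1 _)).
Qed.

Lemma bip_iM h c g : bip 1 h * bip c g =
  \sw_(h1, h2 <- comul h) bip (h1 \act c) (h2 * g).
Proof. by rewrite bip_mul; apply: eq_tsum => h1 h2; rewrite mul1r. Qed.

Lemma sw_bip (W : lmodType k) (F : K -> K -> W) b h : bilin F ->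
  \sw_(x, y <- comul (bip b h)) F x y =
  \sw_(b1, b2 <- comul b) \sw_(g, c <- rho b2) \sw_(h1, h2 <- comul h)
    F (bip b1 (g * h1)) (bip c h2).
Proof.
move=> hF; rewrite bip_comul tsum_tsum //; apply: eq_tsum => b1 b2.
rewrite tsum_tsum //; apply: eq_tsum => g c.
by rewrite tsum_tsum //; apply: eq_tsum => h1 h2; rewrite tsum_ot.
Qed.

(** An [algCoalgType] has no law relating product and coproduct, so this case is derived by hand.
    Right multiplication by $1\times h$ touches only the H-component, hence multiplicativity of the
    coproduct of [H] suffices. *)
Lemma bip_comulMi x h : comul (x * bip 1 h) =
  \sw_(x1, x2 <- comul x) \sw_(h1, h2 <- comul h) (x1 * bip 1 h1 \ot x2 * bip 1 h2).
Proof.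
move: x; apply: bip_ext => [||b g]; [by lin | by lin |].
rewrite bipMi -[LHS]tsum_id !sw_bip; [|by lin|by lin].
apply: eq_tsum => b1 b2; apply: eq_tsum => q c.
rewrite comulM tsum_tsum; last by lin.
apply: eq_tsum => g1 g2; rewrite tsum_tsum; last by lin.
apply: eq_tsum => h1 h2; rewrite tsum_ot; last by lin.
by rewrite !bipMi mulrA.
Qed.

(** Left multiplication acts on the B-component, so the module coalgebra axiom splits the action and
    the Yetter-Drinfeld condition computes the coaction of $h\cdot b_2$. *)
Lemma bip_comuliM x h : comul (bip 1 h * x) =
  \sw_(x1, x2 <- comul x) \sw_(h1, h2 <- comul h) (bip 1 h1 * x1 \ot bip 1 h2 * x2).
Proof.
move: x; apply: bip_ext => [||b g]; [by lin | by lin |].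
rewrite bip_iM (app_tsum _ _ (@comul_linear _ _)) sw_bip; last by lin.
pose T (u : B) (p : H) (v : B) (q : H) := bip u p \ot bip v q.
transitivity (\sw_(b1, b2 <- comul b) \sw_(g1, g2 <- comul g)
  \sw_(p, h' <- comul h) \sw_(q', t <- comul h') \sw_(q, r <- comul q') \sw_(m, e <- rho b2)
     T (p \act b1) ((q * m) * g1) (r \act e) (t * g2)).
  transitivity (\sw_(h1, h2 <- comul h) \sw_(p, q <- comul h1) \sw_(b1, b2 <- comul b)
     \sw_(m, e <- rho (q \act b2)) \sw_(u, v <- comul h2) \sw_(g1, g2 <- comul g)
     T (p \act b1) ((m * u) * g1) e (v * g2)).
    apply: eq_tsum => h1 h2; rewrite -[LHS]tsum_id sw_bip; last by lin.
    rewrite yd_act_comul tsum_tsum; last by lin.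
    apply: eq_tsum => p q; rewrite tsum_tsum; last by lin.
    apply: eq_tsum => b1 b2; rewrite tsum_ot; last by lin.
    apply: eq_tsum => m e; rewrite comulM tsum_tsum; last by lin.
    apply: eq_tsum => u v; rewrite tsum_tsum; last by lin.
    by apply: eq_tsum => g1 g2; rewrite tsum_ot ?mulrA //; lin.
  rewrite comulAE; last by rewrite /T; lin.
  under eq_tsum => p h' do rewrite exchange_tsum.
  rewrite exchange_tsum; apply: eq_tsum => b1 b2.
  rewrite [RHS]exchange_tsum; apply: eq_tsum => p h'.
  (* The Yetter-Drinfeld condition, read backwards, replaces $q\,b_2^{(-1)}\otimes r\cdot b_2^{(0)}$
     by $(q\cdot b_2)^{(-1)}r\otimes(q\cdot b_2)^{(0)}$. *)
  under [RHS]eq_tsum => g1 g2.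
    under eq_tsum => q' t.
      rewrite -(yd_compatE _ _ _ (F := fun x e => T (p \act b1) (x * g1) e (t * g2)));
        last by rewrite /T; lin.
      over.
    rewrite (comulAE (F := fun q r t => \sw_(x, c <- rho (q \act b2))
      T (p \act b1) (x * r * g1) c (t * g2))); last by rewrite /T; lin.
    over.
  rewrite [RHS]exchange_tsum; apply: eq_tsum => q h2.
  rewrite [RHS]exchange_tsum.
  under [RHS]eq_tsum => u v do rewrite exchange_tsum.
  by rewrite [RHS]exchange_tsum.
apply: eq_tsum => b1 b2.
rewrite [RHS]exchange_tsum; apply: eq_tsum => g1 g2.
(* The two products on the right each split their own component of [h], so the fourfold coproduct is
   rebracketed symmetrically. *)
transitivity (\sw_(h1, h2 <- comul h) \sw_(p, q <- comul h1) \sw_(r, t <- comul h2)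
   \sw_(m, e <- rho b2) T (p \act b1) (q * m * g1) (r \act e) (t * g2)).
  rewrite [RHS]comulAE; last by rewrite /T; lin.
  apply: eq_tsum => p h'; rewrite comulAE //; rewrite /T; lin.
rewrite [RHS]exchange_tsum; apply: eq_tsum => h1 h2.
under [RHS]eq_tsum => m e.
  rewrite !bip_iM (app_tsum _ _ (lin_otl _ (@lin_id _ _))).
  under eq_tsum do rewrite (app_tsum _ _ (lin_otr _ (@lin_id _ _))).
  over.
rewrite [RHS]exchange_tsum; apply: eq_tsum => p q.
rewrite [RHS]exchange_tsum; apply: eq_tsum => r t.
by apply: eq_tsum => m e; rewrite /T mulrA.
Qed.

Lemma bip_counitMi (x : K) h : counit (x * bip 1 h) = counit x * counit h :> k.
Proof.
move: x; apply: (bip_ext (W := k^o)) => [||b g]; [by lin | by lin |].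
by rewrite bipMi !bip_counit counitM mulrA.
Qed.

Lemma bip_counitiM h (x : K) : counit (bip 1 h * x) = counit h * counit x :> k.
Proof.
move: x; apply: (bip_ext (W := k^o)) => [||b g]; [by lin | by lin |].
rewrite bip_iM (app_tsum (W' := k^o) _ _ (@counit_linear _ _)).
rewrite -[RHS](sw_counitl (F := fun h => counit h * counit (bip b g) : k^o)); last by lin.
apply: eq_tsum => h1 h2; rewrite !bip_counit counitM yd_act_counit.
by rewrite /GRing.scale /=; ring.
Qed.

Lemma bip_jiP (W : lmodType k) (f g : K -> W) : linear f -> linear g ->
  (forall b h, f (bip b 1 * bip 1 h) = g (bip b 1 * bip 1 h)) -> f =1 g.
Proof.
by move=> hf hg fg; apply: bip_ext => // b h; have := fg b h; rewrite bipMi mul1r.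
Qed.

Let i := bip 1.
Let j b := bip b 1.

Lemma sw_j (W : lmodType k) (F : K -> K -> W) b : bilin F ->
  \sw_(x, y <- comul (j b)) F x y =
  \sw_(b1, b2 <- comul b) \sw_(g, c <- rho b2) F (bip b1 g) (bip c 1).
Proof.
move=> hF; rewrite sw_bip //; do 2!apply: eq_tsum => ? ?.
by rewrite comul1 tsum_ot ?mulr1 //; lin.
Qed.

(** The right leg in [sw_j] is again of the form [j c]. Iterating gives the nesting of coproducts
    and coactions on [b] found on the left-hand side of [yd_pure]. *)
Lemma sw3_j (W : lmodType k) (F : K -> K -> K -> W) b : trilin F ->
  sw3 F (j b) =
  \sw_(b1, b2 <- comul b) \sw_(h, e <- rho b2) \sw_(e1, e2 <- comul e)
    \sw_(g, e20 <- rho e2) F (bip b1 h) (bip e1 g) (bip e20 1).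
Proof.
move=> hF; rewrite /sw3 sw_j; last by lin.
by do 2!apply: eq_tsum => ? ?; rewrite sw_j //; lin.
Qed.

Lemma j_mul b c : j b * j c = j (b * c).
Proof. by rewrite bip_mul comul1 tsum_ot ?yd_act1 ?mulr1 //; lin. Qed.

(** Says that [S] is $\overline{s}$, through its values on generators since [K] is abstract. *)
Definition bip_form (s : tensor B B -> k) (S : tensor K K -> k) : Prop :=
  [/\ scalar s, scalar S & forall b h c g,
      S (bip b h \ot bip c g) = s (b \ot h \act c) * counit g].

(** Balance is associativity of the action, the right counit rule is multiplicativity of the counit
    of [H], and the left one is the H-invariance of [s]. *)
Lemma bip_form_balanced s S : yd_morphism P s -> bip_form s S -> balanced i S.
Proof.
case=> _ s_inv _ [hs hS SE].
have ext2 (f g : K -> K -> k^o) : bilin f -> bilin g ->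
    (forall b h c q, f (bip b h) (bip c q) = g (bip b h) (bip c q)) ->
    forall x y, f x y = g x y.
  move=> hf hg fg x; apply: bip_ext => [||c q]; [exact: hf.2 | exact: hg.2 |].
  by move: x; apply: bip_ext => [||b h]; [exact: hf.1 | exact: hg.1 |].
split=> // [x h y|x y h|h x y].
- move: x y; apply: ext2 => [||b g c q]; [by lin | by lin |].
  rewrite bipMi bip_iM SE (app_tsum (W' := k^o) (g := fun y => S (bip b g \ot y) : k^o));
    last by lin.
  rewrite -[LHS](sw_counitr (F := fun h => s (b \ot (g * h) \act c) * counit q : k^o));
    last by lin.
  apply: eq_tsum => h1 h2; rewrite SE counitM yd_actM /GRing.scale /=; ring.
- move: x y; apply: ext2 => [||b g c q]; [by lin | by lin |].
  by rewrite bipMi !SE counitM; ring.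
- move: x y; apply: ext2 => [||b g c q]; [by lin | by lin |].
  rewrite bip_iM SE mulrA -s_inv.
  rewrite (app_tsum (W' := k^o) (g := fun x => S (x \ot bip c q) : k^o)); last by lin.
  rewrite [RHS]mulrC -[RHS]/(counit q *: (_ : k^o)).
  rewrite [RHS](app_tsum (W := k^o) _ _ (lin_scale _ (@lin_id _ _))).
  by apply: eq_tsum => h1 h2; rewrite SE yd_actM mulrC.
Qed.

Lemma bip_normalized s S : bip_form s S -> normalized s -> normalized S.
Proof.
case=> hs hS SE hn x; rewrite -bip_one; split.
  move: x; apply: (bip_ext (W := k^o)) => [||b h]; [by lin | by lin |].
  by rewrite SE yd_act1 bip_counit (hn b).1.
move: x; apply: (bip_ext (W := k^o)) => [||b h]; [by lin | by lin |].
rewrite SE yd_act_one bip_counit counit1 mulr1 ot_scale.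
by rewrite (scalable_linear hs) (hn b).2 mulrC.
Qed.

(** A form [S] lets the H-part of its left argument act and applies the counit to that of its right
    argument. So the coaction on $a_2$ survives, as in the braided convolution, while the one on
    $b_2$ collapses. *)
Lemma bip_conv s t S T a b : bip_form s S -> bip_form t T ->
  conv S T (j a) (j b) = yd_conv P s t a b.
Proof.
case=> hs hS SE [ht hT TE]; rewrite /conv (sw_j (W := k^o)); last by lin.
do 2!apply: eq_tsum => ? ?; rewrite (sw_j (W := k^o)); last by lin.
apply: eq_tsum => b1 b2.
rewrite -[RHS](sw_coact_counit P (F := fun b => s (_ \ot _) * t (_ \ot b) : k^o)); last by lin.
by apply: eq_tsum => h c; rewrite SE TE yd_act1 counit1 mulr1 /GRing.scale /=; ring.
Qed.

Lemma bip_normalized_invertible s t S T : bip_form s S -> bip_form t T ->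
  yd_normalized_invertible P s t -> normalized_invertible S T.
Proof.
move=> sS tT [s_yd t_yd hn hi].
have [hS hT] : scalar S /\ scalar T by case: sS tT => [_ ? _] [_ ? _].
have bS := bip_form_balanced s_yd sS; have bT := bip_form_balanced t_yd tT.
split=> //; first exact: bip_normalized sS hn.
have E := conv_balanced bip_comulMi bip_comuliM bip_counitMi bip_counitiM bip_jiP.
move=> x y; split; [apply: (E _ _ bS bT) | apply: (E _ _ bT bS)] => a b.
  by rewrite (bip_conv _ _ sS tT) !bip_counit counit1 !mulr1 (hi a b).1.
by rewrite (bip_conv _ _ tT sS) !bip_counit counit1 !mulr1 (hi a b).2.
Qed.

(** * Transfer of the neat, cocycle, lazy and pure identities *)

Lemma bip_neat s S : yd_morphism P s -> bip_form s S ->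
  (forall a b c : B,
    \sw_(b1, b2 <- comul b) (s (a \ot b1) * s (b2 \ot c)) =
    \sw_(g, a0 <- rho a) \sw_(b1, b2 <- comul b)
      (s (g \act b1 \ot c) * s (a0 \ot b2))) ->
  forall a b c : K,
    \sw_(b1, b2 <- comul b) (S (a \ot b1) * S (b2 \ot c)) =
    \sw_(b1, b2 <- comul b) (S (b1 \ot c) * S (a \ot b2)).
Proof.
move=> s_yd sS hn; have bS := bip_form_balanced s_yd sS; have [hs hS SE] := sS.
apply: (neat_balanced (bip_bilin.2 1) bip_comulMi bip_comuliM bip_jiP bS) => a b c.
rewrite /neat_lhs /neat_rhs !(sw_j (W := k^o)); [|by lin|by lin].
transitivity (\sw_(b1, b2 <- comul b) (s (a \ot b1) * s (b2 \ot c)) : k^o).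
  apply: eq_tsum => b1 b2.
  rewrite -[RHS](sw_coact_counit P (F := fun b => s (a \ot b1) * s (b \ot c) : k^o));
    last by lin.
  by apply: eq_tsum => h e; rewrite !SE !yd_act1 counit1 !mulr1 /GRing.scale /=; ring.
rewrite hn exchange_tsum; apply: eq_tsum => b1 b2.
under eq_tsum do rewrite (yd_act_antipode s_yd) mulrC.
(* The antipode now acts on [c], so the coaction on [a] can be traded for the coaction on [b2] that
   comes from the coproduct of [j b]. *)
rewrite (yd_colinear_antipode s_yd _ _ (W := k^o) (Z := fun h => s (b1 \ot h \act c)));
  last by lin.
by apply: eq_tsum => h e; rewrite !SE !yd_act1 counit1 !mulr1 mulrC.
Qed.

Lemma bip_cocycle s S : yd_morphism P s -> bip_form s S ->
  (forall a b c : B,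
    \sw_(a1, a2 <- comul a) \sw_(g, a20 <- rho a2) \sw_(b1, b2 <- comul b)
      (s (a1 \ot g \act b1) * s (a20 * b2 \ot c)) =
    \sw_(b1, b2 <- comul b) \sw_(g, b20 <- rho b2) \sw_(c1, c2 <- comul c)
      (s (b1 \ot g \act c1) * s (a \ot b20 * c2))) ->
  forall a b c : K,
    \sw_(a1, a2 <- comul a) \sw_(b1, b2 <- comul b)
      (S (a1 \ot b1) * S (a2 * b2 \ot c)) =
    \sw_(b1, b2 <- comul b) \sw_(c1, c2 <- comul c)
      (S (b1 \ot c1) * S (a \ot b2 * c2)).
Proof.
move=> s_yd sS hc; have bS := bip_form_balanced s_yd sS; have [hs hS SE] := sS.
have [bi_l bi_r] := bip_bilin.
apply: (cocycle_balanced (bip_bilin.2 1) bip_comulMi bip_comuliM bip_jiP bS) => a b c.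
rewrite /cocycle_lhs /cocycle_rhs !(sw_j (W := k^o)); [|by lin|by lin].
transitivity (\sw_(a1, a2 <- comul a) \sw_(g, a20 <- rho a2) \sw_(b1, b2 <- comul b)
      (s (a1 \ot g \act b1) * s (a20 * b2 \ot c)) : k^o).
  do 2!apply: eq_tsum => ? ?; rewrite (sw_j (W := k^o)); last by lin.
  apply: eq_tsum => b1 b2.
  rewrite -[RHS](sw_coact_counit P (F := fun b => s (_ \ot _) * s (_ * b \ot c) : k^o));
    last by lin.
  apply: eq_tsum => h e; rewrite j_mul !SE !yd_act1 counit1 mulr1 /GRing.scale /=; ring.
rewrite hc; do 2!apply: eq_tsum => ? ?; rewrite (sw_j (W := k^o)); last by lin.
apply: eq_tsum => c1 c2.
rewrite -[LHS](sw_coact_counit P (F := fun c => s (_ \ot _) * s (a \ot _ * c) : k^o));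
    last by lin.
apply: eq_tsum => h e; rewrite j_mul !SE !yd_act1 counit1 mulr1 /GRing.scale /=; ring.
Qed.

Lemma bip_lazy s S : yd_morphism P s -> bip_form s S ->
  (forall b c : B,
    \sw_(b1, b2 <- comul b) \sw_(g, b20 <- rho b2) \sw_(c1, c2 <- comul c)
      (s (b1 \ot g \act c1) *: (b20 * c2)) =
    \sw_(b1, b2 <- comul b) \sw_(g, b20 <- rho b2) \sw_(c1, c2 <- comul c)
      (s (b20 \ot c2) *: (b1 * (g \act c1)))) ->
  forall x y : K,
    \sw_(x1, x2 <- comul x) \sw_(y1, y2 <- comul y) (S (x1 \ot y1) *: (x2 * y2)) =
    \sw_(x1, x2 <- comul x) \sw_(y1, y2 <- comul y) (S (x2 \ot y2) *: (x1 * y1)).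
Proof.
move=> s_yd sS hl; have bS := bip_form_balanced s_yd sS; have [hs hS SE] := sS.
have [bi_l bi_r] := bip_bilin; have hj : linear j by exact: bi_l.
apply: (lazy_balanced (bip_bilin.2 1) bip_comulMi bip_comuliM bip_jiP bS) => b c.
rewrite /lazy_lhs /lazy_rhs !sw_j; [|by lin|by lin].
(* The lazy identity of [B] is embedded in [K] by [j]. On its left side the extra coaction on $c_2$
   is a counit; the right side needs colinearity. *)
have := congr1 j (hl b c); rewrite !(app_tsum _ _ hj) => E.
transitivity (\sw_(b1, b2 <- comul b) j (\sw_(g, b20 <- rho b2) \sw_(c1, c2 <- comul c)
      (s (b1 \ot g \act c1) *: (b20 * c2)))).
  apply: eq_tsum => b1 b2; rewrite (app_tsum _ _ hj); apply: eq_tsum => g b20.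
  rewrite (app_tsum _ _ hj) sw_j; last by lin.
  apply: eq_tsum => c1 c2.
  rewrite -[RHS](sw_coact_counit P (F := fun c => j (s (b1 \ot g \act c1) *: (b20 * c))));
    last by lin.
  apply: eq_tsum => h c20.
  by rewrite j_mul SE (scalable_linear hj) scalerA mulrC.
rewrite E; apply: eq_tsum => b1 b2; rewrite (app_tsum _ _ hj).
transitivity (\sw_(c1, c2 <- comul c) \sw_(g, b20 <- rho b2)
    (s (b20 \ot c2) *: j (b1 * (g \act c1)))).
  rewrite [RHS]exchange_tsum; apply: eq_tsum => g b20; rewrite (app_tsum _ _ hj).
  by apply: eq_tsum => c1 c2; rewrite (scalable_linear hj).
under [RHS]eq_tsum do (rewrite sw_j; last by lin).
rewrite [RHS]exchange_tsum; apply: eq_tsum => c1 c2.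
(* Colinearity of [s] replaces the H-component 1 by $b_2^{(0)(-1)}c_2^{(-1)}$. Merging the two
   coactions on $b_2$ into a coproduct then gives the product of the first legs in [K]. *)
transitivity (\sw_(g, b20 <- rho b2) \sw_(f, b200 <- rho b20) \sw_(h, c20 <- rho c2)
   (s (b200 \ot c20) *: bip (b1 * (g \act c1)) (f * h))).
  apply: eq_tsum => g b20.
  by rewrite (yd_colinearE s_yd _ _ (Z := bip (b1 * (g \act c1)))).
rewrite -yd_coactAE; last by lin.
apply: eq_tsum => g b20; rewrite exchange_tsum; apply: eq_tsum => h c20.
rewrite SE yd_act1 counit1 mulr1 bip_mul.
by rewrite (app_tsum _ _ (lin_scale _ (@lin_id _ _))).
Qed.

Lemma bip_jM a b h : j a * bip b h = bip (a * b) h.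
Proof. by rewrite bip_mul comul1 tsum_ot ?yd_act1 ?mul1r //; lin. Qed.

Lemma bip_formMj s S b h c m d : bip_form s S ->
  S (bip b h \ot bip c m * j d) = s (b \ot h \act (c * m \act d)).
Proof.
case=> hs hS SE.
rewrite bip_mul (app_tsum (W' := k^o) (g := fun y => S (bip b h \ot y) : k^o)); last by lin.
rewrite -[RHS](sw_counitr (F := fun m => s (b \ot h \act (c * m \act d)) : k^o));
  last by lin.
by apply: eq_tsum => m1 m2; rewrite SE mulr1 mulrC.
Qed.

Lemma bip_pure s t S T :
  yd_morphism P s -> yd_morphism P t -> bip_form s S -> bip_form t T ->
  (forall a b c d : B,
    \sw_(b1, b2 <- comul b) \sw_(h, e <- rho b2)
    \sw_(e1, e2 <- comul e) \sw_(g, e20 <- rho e2)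
    \sw_(c1, c' <- comul c) \sw_(c2, c3 <- comul c')
      (s (a * b1 \ot h \act c1) * t (e1 \ot g \act c2) * s (e20 \ot c3 * d)) =
    \sw_(b1, b2 <- comul b) \sw_(h, e <- rho b2)
    \sw_(e1, e2 <- comul e) \sw_(g, e20 <- rho e2) \sw_(f, e200 <- rho e20)
    \sw_(c1, c' <- comul c) \sw_(c2, c3 <- comul c') \sw_(l, c30 <- rho c3)
      (s (b1 \ot (h \act c1) * ((f * l) \act d)) * t (e1 \ot g \act c2) *
       s (a * e200 \ot c30))) ->
  forall a b c d : K, pure_lhs S T a b c d = pure_rhs S T a b c d.
Proof.
move=> s_yd t_yd sS tT hp.
have bS := bip_form_balanced s_yd sS; have [hs hS SE] := sS.
have bT := bip_form_balanced t_yd tT; have [ht hT TE] := tT.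
have [bi_l bi_r] := bip_bilin.
apply: (pure_balanced (bip_bilin.2 1) bip_comulMi bip_comuliM bip_jiP bS bT) => a b c d.
(* On the left-hand side the coactions on the parts of [c] meet only counits and collapse. *)
transitivity (\sw_(b1, b2 <- comul b) \sw_(h, e <- rho b2)
    \sw_(e1, e2 <- comul e) \sw_(g, e20 <- rho e2) sw3 (fun c1 c2 c3 =>
      s (a * b1 \ot h \act c1) * t (e1 \ot g \act c2) * s (e20 \ot c3 * d)) c : k^o).
  rewrite /pure_lhs (sw3_j (W := k^o)); last by lin.
  do 4!apply: eq_tsum => ? ?.
  rewrite (sw3_j (W := k^o)); last by lin.
  rewrite -(sw3_coact_counit P (W := k^o)); last by lin.
  do 4!apply: eq_tsum => ? ?; rewrite bip_jM j_mul !SE TE yd_act1 counit1.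
  by rewrite /GRing.scale /=; ring.
rewrite [LHS]hp /pure_rhs (sw3_j (W := k^o)); last by lin.
apply: eq_tsum => b1 b2.
transitivity (sw3 (fun c1 c2 c3 => \sw_(h, e <- rho b2)
    \sw_(e1, e2 <- comul e) \sw_(g, e20 <- rho e2) \sw_(f, e200 <- rho e20)
    \sw_(l, c30 <- rho c3)
      (s (b1 \ot (h \act c1) * ((f * l) \act d)) * t (e1 \ot g \act c2) *
       s (a * e200 \ot c30))) c : k^o).
  by do 4!(rewrite -exchange_tsum3; apply: eq_tsum => ? ?).
(* The right-hand side in [K]: the comodule coalgebra axiom splits the coaction on $c'$ into
   coactions [m] on $c_2$ and [l] on $c_3$, and [h] acts on the whole product with [d]. *)
transitivity (sw3 (fun c1 c2 c3 => \sw_(h, e <- rho b2)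
    \sw_(e1, e2 <- comul e) \sw_(g, e20 <- rho e2) \sw_(m, c20 <- rho c2)
    \sw_(l, c30 <- rho c3)
      (s (b1 \ot h \act (c1 * ((m * l) \act d))) * t (e1 \ot g \act c20) *
       s (a * e20 \ot c30))) c : k^o); last first.
  rewrite -exchange_tsum3; apply: eq_tsum => h e.
  rewrite -exchange_tsum3; apply: eq_tsum => e1 e2.
  rewrite -exchange_tsum3; apply: eq_tsum => g e20.
  rewrite (sw3_j (W := k^o)); last by lin.
  apply: eq_tsum => c1 c'; rewrite -(yd_coact_comulE (W := k^o) P (F := fun m c2 c3 =>
     s (b1 \ot h \act (c1 * (m \act d))) * t (e1 \ot g \act c2) * s (a * e20 \ot c3)));
    last by lin.
  apply: eq_tsum => m c0; apply: eq_tsum => c2 c3.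
  rewrite -[LHS](sw_coact_counit P (F := fun c3 => s (b1 \ot h \act (c1 * (m \act d))) *
    t (e1 \ot g \act c2) * s (a * e20 \ot c3) : k^o)); last by lin.
  apply: eq_tsum => l c30.
  rewrite bip_jM (bip_formMj _ _ _ _ _ sS) SE TE yd_act1 counit1.
  by rewrite /GRing.scale /=; ring.
apply: eq_sw3 => c1 c2 c3.
(* [X] gathers the two values of [s], so that colinearity of the inverse [t] can be used through
   [yd_pure_core]: it trades the second coaction [f] for [h2 * m]. *)
pose X (h f : H) (e : B) : k^o := \sw_(l, c30 <- rho c3)
  (s (b1 \ot (h \act c1) * ((f * l) \act d)) * s (a * e \ot c30)).
transitivity (\sw_(h, e <- rho b2) \sw_(e1, e2 <- comul e) \sw_(g, e20 <- rho e2)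
    \sw_(f, e200 <- rho e20) (t (e1 \ot g \act c2) *: X h f e200)).
  do 4!apply: eq_tsum => ? ?.
  rewrite (app_tsum (W := k^o) _ _ (lin_scale _ (@lin_id _ _))); apply: eq_tsum => l c30.
  by rewrite /GRing.scale /=; ring.
rewrite (yd_pure_core t_yd); last by rewrite /X; lin.
apply: eq_tsum => h e; rewrite exchange_tsum; apply: eq_tsum => e1 e2.
rewrite exchange_tsum; apply: eq_tsum => g e20.
rewrite exchange_tsum; apply: eq_tsum => m c20.
under eq_tsum do rewrite (app_tsum (W := k^o) _ _ (lin_scale _ (@lin_id _ _))).
rewrite exchange_tsum; apply: eq_tsum => l c30.
(* The components $h_1$ on $c_1$ and $h_2$ on the translate of [d] recombine, by the module algebra
   axiom, into [h] acting on the product. *)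
rewrite yd_act_mul.
rewrite (app_tsum (W' := k^o) (g := fun x => s (b1 \ot x) * t (e1 \ot g \act c20) *
  s (a * e20 \ot c30) : k^o)); last by lin.
apply: eq_tsum => h1 h2; rewrite -!yd_actM !mulrA /GRing.scale /=; ring.
Qed.

End Biproduct.

(** * Instantiation at the Radford biproduct *)

Section Overline.
Variables (k : fieldType) (H : hopfAlgType k) (B : algCoalgType k).
Variable P : admissible_pair H B.
Local Notation K := (biproduct P).

Let bip (b : B) (h : H) : K := b \ot h.

Let bip_bilin : bilin bip.
Proof. exact: ot_bilin. Qed.
Let bip_ext (W : lmodType k) (f g : K -> W) : linear f -> linear g ->
  (forall b h, f (bip b h) = g (bip b h)) -> f =1 g.
Proof. exact: tensor_ext. Qed.
Let bip_mulE b h c g : bip b h * bip c g =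
  \sw_(h1, h2 <- comul h) bip (b * yd_act P h1 c) (h2 * g).
Proof. exact: biproduct_mulE. Qed.
Let bip_comulE b h : comul (bip b h) =
  \sw_(b1, b2 <- comul b) \sw_(g, c <- yd_coact P b2) \sw_(h1, h2 <- comul h)
    (bip b1 (g * h1) \ot bip c h2).
Proof. exact: biproduct_comulE. Qed.
Let bip_counitE b h : counit (bip b h) = counit b * counit h :> k.
Proof. exact: biproduct_counitE. Qed.

Lemma overline_form s : scalar s -> bip_form P bip s (overline P s).
Proof.
move=> hs; split=> // [|b h c g]; last exact: overlineE.
have hl : linear (s : _ -> k^o) by [].
have hb : bilin (fun x y : tensor B H => \sw_(b, h <- x) \sw_(c, g <- y)
  (s (b \ot yd_act P h c) * counit g) : k^o) by lin.
exact: (tsum_linear hb).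
Qed.

Lemma overline_normalized_invertible s t : yd_normalized_invertible P s t ->
  normalized_invertible (overline P s) (overline P t).
Proof.
move=> hst; have [[hs _ _] [ht _ _] _ _] := hst.
exact: (bip_normalized_invertible bip_bilin bip_ext bip_mulE bip_comulE bip_counitE
  (erefl _) (overline_form hs) (overline_form ht) hst).
Qed.

Lemma overline_pure s : yd_pure P s -> pure_form (overline P s).
Proof.
case=> t hst E; exists (overline P t); first exact: overline_normalized_invertible.
have [s_yd t_yd _ _] := hst; have [[hs _ _] [ht _ _]] := (s_yd, t_yd).
exact: (bip_pure bip_bilin bip_ext bip_mulE bip_comulE s_yd t_yd
  (overline_form hs) (overline_form ht) E).
Qed.

Lemma overline_neat s : yd_neat P s -> neat_form (overline P s).
Proof.
case=> -[t hst] E; split.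
  by exists (overline P t); exact: overline_normalized_invertible.
have [s_yd _ _ _] := hst; have [hs _ _] := s_yd.
exact: (bip_neat bip_bilin bip_ext bip_mulE bip_comulE s_yd (overline_form hs) E).
Qed.

Lemma overline_lazy s : yd_lazy P s -> lazy_form (overline P s).
Proof.
case=> -[t hst] E; split.
  by exists (overline P t); exact: overline_normalized_invertible.
have [s_yd _ _ _] := hst; have [hs _ _] := s_yd.
exact: (bip_lazy bip_bilin bip_ext bip_mulE bip_comulE s_yd (overline_form hs) E).
Qed.

Lemma overline_cocycle s : yd_cocycle P s -> cocycle_form (overline P s).
Proof.
case=> -[t hst] E; split.
  by exists (overline P t); exact: overline_normalized_invertible.
have [s_yd _ _ _] := hst; have [hs _ _] := s_yd.
exact: (bip_cocycle bip_bilin bip_ext bip_mulE bip_comulE s_yd (overline_form hs) E).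
Qed.

End Overline.

Theorem theorem4p7 (k : fieldType) (H : hopfAlgType k) (B : algCoalgType k)
    (P : admissible_pair H B) (s : tensor B B -> k) :
  bijective (antipode : H -> H) ->
  hopf_admissible P ->
  [/\ yd_pure P s -> pure_form (overline P s),
      yd_neat P s -> neat_form (overline P s),
      yd_pure P s /\ yd_lazy P s /\ yd_cocycle P s ->
        pure_form (overline P s) /\ lazy_form (overline P s) /\
        cocycle_form (overline P s)
    & yd_neat P s /\ yd_lazy P s /\ yd_cocycle P s ->
        neat_form (overline P s) /\ lazy_form (overline P s) /\
        cocycle_form (overline P s)].
Proof.
move=> _ _; split.
- exact: overline_pure.
- exact: overline_neat.
- by case=> /overline_pure ? [/overline_lazy ? /overline_cocycle ?].
- by case=> /overline_neat ? [/overline_lazy ? /overline_cocycle ?].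
Qed.
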